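(* Let $\sum_{j=0}^\infty|a(j)|<\infty$, $\sum_{j=0}^\infty(j+1)|a(j)|^2<\infty$, $P_2>0$, and $D_g^0=\{g:\frac1{2\pi}\int_{-\pi}^\pi g(\lambda)d\lambda\le P_2\}$. Let the spectral density $f(\lambda)$ be known and fixed and let $g_0\in D_g^0$ be such that $(f(\lambda)+g_0(\lambda))^{-1}$ is integrable. Put $C^0(e^{i\lambda})=\sum_{j=0}^\infty((\mathbf B^0)^{-1}\mathbf R^0\mathbf a)_je^{ij\lambda}$ and let the function $$h_g(f,g_0)=\frac{|A(e^{i\lambda})f(\lambda)-C^0(e^{i\lambda})|^2}{(f(\lambda)+g_0(\lambda))^2}$$ be bounded. Suppose that for some constant $\alpha_2>0$ $$g_0(\lambda)=\max\left\{0,\ \alpha_2^{-1}\left|A(e^{i\lambda})f(\lambda)-C^0(e^{i\lambda})\right|-f(\lambda)\right\}$$ and that $(f,g_0)$ determines a solution to the optimization problem $$\max_{g\in D_g^0}\left(\langle\mathbf R\mathbf a,\mathbf B^{-1}\mathbf R\mathbf a\rangle+\langle\mathbf Q\mathbf a,\mathbf a\rangle\right)=\langle\mathbf R^0\mathbf a,(\mathbf B^0)^{-1}\mathbf R^0\mathbf a\rangle+\langle\mathbf Q^0\mathbf a,\mathbf a\rangle.$$ Then $g_0$ is the least favourable spectral density in $D_g^0$ for the optimal estimation of $A\xi=\sum_{j=0}^\infty a(j)\xi(j)$ based on observations of $\xi(j)+\eta(j)$ at $j=-1,-2,\dots$, and $$h^0(e^{i\lambda})=\frac{A(e^{i\lambda})f(\lambda)-C^0(e^{i\lambda})}{f(\lambda)+g_0(\lambda)}$$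 is the minimax-robust spectral characteristic of the optimal linear estimate of $A\xi$.
   Context: $\xi,\eta$ are zero mean mutually uncorrelated wide sense stationary sequences with spectral densities $f,g$ ($E\xi(j+k)\overline{\xi(j)}=\frac1{2\pi}\int e^{ik\lambda}f\,d\lambda$, etc.). $A(e^{i\lambda})=\sum_{j\ge0}a(j)e^{ij\lambda}$, $\mathbf a=(a(0),a(1),\dots)$, $\langle x,y\rangle=\sum_kx(k)\overline{y(k)}$. $\mathbf B,\mathbf R,\mathbf Q$ are the linear operators in $\ell_2$ with matrices ($j,k\ge0$) $B_{j,k}=\frac1{2\pi}\int_{-\pi}^\pi e^{-i(j-k)\lambda}\frac{1}{f+g}d\lambda$, $R_{j,k}=\frac1{2\pi}\int_{-\pi}^\pi e^{-i(j-k)\lambda}\frac{f}{f+g}d\lambda$, $Q_{j,k}=\frac1{2\pi}\int_{-\pi}^\pi e^{-i(j-k)\lambda}\frac{fg}{f+g}d\lambda$; $\mathbf B^0,\mathbf R^0,\mathbf Q^0$ are those for $(f,g_0)$. Wherever $\mathbf B^{-1}$ is used, $(f,g)$ is understood to satisfy $\int(f+g)^{-1}d\lambda<\infty$ and $\mathbf B$ to be a bounded operator in $\ell_2$ with bounded inverse. $L_2^0(f+g)$ is the closed span of $e^{ij\lambda}$, $j\le-1$, in $L_2(f+g)$; for $h\in L_2^0(f+g)$, $\Delta(h;f,g)=\frac1{2\pi}\int|A-h|^2f\,d\lambda+\frac1{2\pi}\int|h|^2g\,d\lambda$, and $h(f,g)$ is its minimizer. With $f$ fixed and $D=\{f\}\times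 D_g^0$: $g_0$ is least favourable if $\Delta(h(f,g_0);f,g_0)=\max_{g\in D_g^0}\Delta(h(f,g);f,g)$; $h^0$ is minimax-robust if $h^0\in H_D=\bigcap_{g\in D_g^0}L_2^0(f+g)$ and $\min_{h\in H_D}\max_{g\in D_g^0}\Delta(h;f,g)=\sup_{g\in D_g^0}\Delta(h^0;f,g)$. *)

(* Defs.v *)
From HB Require Import structures.
From mathcomp Require Import all_boot all_order all_algebra.
From mathcomp Require Export complex.
From mathcomp Require Import all_classical all_reals all_analysis.

Set Implicit Arguments.
Unset Strict Implicit.
Unset Printing Implicit Defensive.

Import Order.TTheory GRing.Theory Num.Theory.
Import numFieldNormedType.Exports.

Local Open Scope classical_set_scope.
Local Open Scope ring_scope.
Local Open Scope complex_scope.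

Section ComplexAnalysis.
Context {R : realType}.

Definition cabs (z : R[i]) : R := ComplexField.Normc.normc z.

Definition expi (t : R) : R[i] := cos t +i* sin t.

(* Complex series are taken componentwise; [csum u] is meaningful only when
   [csummable u] holds. *)
Definition csummable (u : nat -> R[i]) : Prop :=
  cvgn (series (fun k => complex.Re (u k))) /\
  cvgn (series (fun k => complex.Im (u k))).

Definition csum (u : nat -> R[i]) : R[i] :=
  limn (series (fun k => complex.Re (u k))) +i*
  limn (series (fun k => complex.Im (u k))).

Definition circle : set R := `[- pi, pi].

Definition cmeasurable (h : R -> R[i]) : Prop :=
  measurable_fun circle (fun l => complex.Re (h l)) /\
  measurable_fun circle (fun l => complex.Im (h l)).

Definition cintegral (h : R -> R[i]) : R[i] :=
  (\int[@lebesgue_measure R]_(l in circle) complex.Re (h l)) +i*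
  (\int[@lebesgue_measure R]_(l in circle) complex.Im (h l)).

(* The integral of |h|^2 w over [-pi, pi], without the factor 1/(2 pi). *)
Definition sqnormL2 (w : R -> R) (h : R -> R[i]) : \bar R :=
  (\int[@lebesgue_measure R]_(l in circle) (cabs (h l) ^+ 2 * w l)%:E)%E.

End ComplexAnalysis.

Section SquareSummable.
Context {R : realType}.
Implicit Types (x y : nat -> R[i]) (M : nat -> nat -> R[i]).

Definition ell2 x : Prop := cvgn (series (fun k => cabs (x k) ^+ 2)).

Definition ell2norm x : R :=
  Num.sqrt (limn (series (fun k => cabs (x k) ^+ 2))).

Definition inner x y : R[i] := csum (fun k => x k * conjc (y k)).

Definition bounded_op (T : (nat -> R[i]) -> (nat -> R[i])) : Prop :=
  exists K : R, forall x, ell2 x ->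
    ell2 (T x) /\ ell2norm (T x) <= K * ell2norm x.

Definition mxop M x : nat -> R[i] := fun j => csum (fun k => M j k * x k).

Definition mx_bounded M : Prop :=
  (forall x, ell2 x -> forall j, csummable (fun k => M j k * x k)) /\
  bounded_op (mxop M).

(* T is automatically linear on l2, being inverse to a linear map. *)
Definition mx_bounded_inverse M : Prop :=
  exists T : (nat -> R[i]) -> (nat -> R[i]), bounded_op T /\
    forall x, ell2 x -> T (mxop M x) = x /\ mxop M (T x) = x.

(* The solution x in l2 of M x = y, unique when M is invertible on l2. *)
Definition mxinv M y : nat -> R[i] :=
  xget (fun=> 0) [set x | ell2 x /\ mxop M x = y].

End SquareSummable.

Section Estimation.
Context {R : realType}.
Implicit Types (a : nat -> R[i]) (f g : R -> R) (h : R -> R[i]) (P : R).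

Definition spectral_density f : Prop :=
  (forall l, circle l -> 0 <= f l) /\
  (@lebesgue_measure R).-integrable circle (EFin \o f).

(* The inverse is that of \bar R, where 0^-1 = +oo; hence this forces
   f + g > 0 almost everywhere. *)
Definition inv_integrable f g : Prop :=
  (@lebesgue_measure R).-integrable circle (fun l => ((f l + g l)%:E^-1)%E).

Definition toeplitz (phi : R -> R) (j k : nat) : R[i] :=
  ((2 * pi)^-1)%:C *
  cintegral (fun l => expi (- (j%:R - k%:R) * l) * (phi l)%:C).

Definition opB f g := toeplitz (fun l => (f l + g l)^-1).
Definition opR f g := toeplitz (fun l => f l / (f l + g l)).
Definition opQ f g := toeplitz (fun l => f l * g l / (f l + g l)).

(* The standing assumption under which B^{-1} is used. *)
Definition admissible f g : Prop :=
  [/\ inv_integrable f g, mx_bounded (opB f g) & mx_bounded_inverse (opB f g)].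

(* A(e^{il}) as a function of l. *)
Definition Afun a (l : R) : R[i] := csum (fun j => a j * expi (j%:R * l)).

Definition spectralC a f g : nat -> R[i] := mxinv (opB f g) (mxop (opR f g) a).

(* h(e^{il}) = \sum_(j >= 0) c j e^{ijl}; for c in l2 the series converges in
   L2, so it defines h only up to almost everywhere equality. *)
Definition is_L2_sum (c : nat -> R[i]) h : Prop :=
  cmeasurable h /\
  sqnormL2 (fun=> 1)
    (fun l => h l - \sum_(j < n) c j * expi (j%:R * l)) @[n --> \oo] --> 0%E.

(* <Ra, B^{-1} Ra> + <Qa, a>. *)
Definition objective a f g : R[i] :=
  inner (mxop (opR f g) a) (spectralC a f g) + inner (mxop (opQ f g) a) a.

Definition past_poly (p : R -> R[i]) : Prop :=
  exists (n : nat) (c : nat -> R[i]),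
    p = fun l => \sum_(k < n) c k * expi (- k.+1%:R * l).

(* The closed span of e^{ijl}, j <= -1, in L_2(f + g). *)
Definition L2past f g : set (R -> R[i]) :=
  [set h | [/\ cmeasurable h,
    (sqnormL2 (fun l => (f l + g l)%R) h < +oo)%E &
    forall e : R, 0 < e -> exists2 p, past_poly p &
      (sqnormL2 (fun l => (f l + g l)%R) (fun l => (h l - p l)%R) < e%:E)%E]].

Definition Delta a h f g : \bar R :=
  (((2 * pi)^-1)%:E * sqnormL2 f (fun l => (Afun a l - h l)%R) +
   ((2 * pi)^-1)%:E * sqnormL2 g h)%E.

(* h is (a representative of) the minimizer h(f, g). *)
Definition optimal_char a f g h : Prop :=
  L2past f g h /\
  forall h', L2past f g h' -> (Delta a h f g <= Delta a h' f g)%E.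

Definition Dg0 P : set (R -> R) :=
  [set g | spectral_density g /\
    (2 * pi)^-1 * \int[@lebesgue_measure R]_(l in circle) g l <= P].

Definition least_favourable a f (D : set (R -> R)) (g0 : R -> R) : Prop :=
  D g0 /\
  exists2 h0, optimal_char a f g0 h0 &
    forall g, D g -> forall h, optimal_char a f g h ->
      (Delta a h f g <= Delta a h0 f g0)%E.

Definition HD f (D : set (R -> R)) : set (R -> R[i]) :=
  \bigcap_(g in D) L2past f g.

(* As h0 belongs to H_D, the infimum below is attained at h0. *)
Definition minimax_robust a f (D : set (R -> R)) (h0 : R -> R[i]) : Prop :=
  HD f D h0 /\
  ereal_inf [set ereal_sup [set Delta a h f g | g in D] | h in HD f D] =
  ereal_sup [set Delta a h0 f g | g in D].

End Estimation.

(* Main.v *)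
Require Import Defs.
From mathcomp Require Import all_boot all_order all_algebra complex.
From mathcomp Require Import all_classical all_reals all_analysis.
From mathcomp Require Import measurable_realfun ring lra.

Import Order.TTheory GRing.Theory Num.Theory.
Import numFieldNormedType.Exports.

Local Open Scope classical_set_scope.
Local Open Scope ring_scope.
Local Open Scope complex_scope.

Set Implicit Arguments.
Unset Strict Implicit.
Unset Printing Implicit Defensive.

(** Write h0 = (A f - C) / (f + g0).  The equation for g0 says that |h0| <= alpha2
    almost everywhere, with equality where g0 > 0.  Boundedness of the Toeplitz
    operator B forces its symbol 1 / (f + g0) to be bounded (its quadratic form on
    characters is a Fejer mean of the symbol), so B c = R a says that the
    nonnegative Fourier coefficients of h0 vanish.  The Fejer means of h0 are then
    uniformly bounded polynomials in the past, so h0 lies in L2past f g for every g,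
    and it is optimal for g0 by orthogonality.

    If the power constraint is tight, the integral of |h0|^2 g is at most
    alpha2^2 times that of g, hence at most that of |h0|^2 g0, so (h0, g0) is a
    saddle point.  If it is slack, moving to g0 + e (f + g0) divides B and R by
    1 + e and fixes C; maximality of g0 then bounds the whole energy of A xi by the
    objective, which forces h0 = 0. *)

(** [C] is only an L2 function, known up to null sets, while [f] and [g] are merely integrable. The
    product of [C] with 1 / (f + g0) need not be integrable a priori, so the entrywise series of B c
    cannot be read as Fourier coefficients before the symbol is known to be bounded. Fejer means
    replace partial sums because their kernel is positive: essential bounds survive, and a uniformly
    bounded family converging in L1 also converges in the square norm for every integrable weight,
    by truncating the weight. [Delta a h0 f g] depends on [g] only through the integral of |h0|^2 g,
    so the saddle property is a linear problem in [g], with alpha2^2 as multiplier of the power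
    constraint. There, with E the energy of A xi, the objective at g0 + e (f + g0) is (objective + e
    E) / (1 + e), so maximality gives E <= objective; orthogonality identifies 2 pi (E - objective)
    with the integral of |h0|^2 (f + g0). *)

Section RealCircleIntegral.
Context {R : realType}.
Implicit Types (u v : R -> R) (P Q : R -> Prop).

(** * Integrals of real functions over the circle *)

Definition rint u : R := \int[@lebesgue_measure R]_(l in circle) u l.

Definition rintegrable u : Prop :=
  (@lebesgue_measure R).-integrable circle (EFin \o u).

(** Membership in [circle] sits under the quantifier, so the hypothesis of the theorem on [g0] has
    this form by conversion. *)
Definition ae_circle P : Prop :=
  {ae @lebesgue_measure R, forall l, circle l -> P l}.

Lemma ae_circleW P : (forall l, circle l -> P l) -> ae_circle P.
Proof. by move=> h; apply: aeW => l; exact: h. Qed.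

Lemma ae_circle_imp P Q :
  (forall l, circle l -> P l -> Q l) -> ae_circle P -> ae_circle Q.
Proof.
have F : Filter (almost_everywhere (@lebesgue_measure R)) by typeclasses eauto.
by move=> h; apply: (@filterS _ _ F) => l hP cl; exact: h (hP cl).
Qed.

Lemma ae_circle_and P Q :
  ae_circle P -> ae_circle Q -> ae_circle (fun l => P l /\ Q l).
Proof.
have F : Filter (almost_everywhere (@lebesgue_measure R)) by typeclasses eauto.
by apply: (@filterS2 _ _ F) => l hP hQ cl; split; [exact: hP|exact: hQ].
Qed.

Lemma measurable_circle : measurable (circle : set R).
Proof. exact: measurable_itv. Qed.
Hint Resolve measurable_circle : core.

Lemma measure_circle : lebesgue_measure (circle : set R) = (2 * pi)%:E.
Proof.
rewrite /circle lebesgue_measure_itv /= lte_fin.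
have p0 := @pi_gt0 R.
by rewrite ifT; [rewrite -EFinB; congr EFin; lra|lra].
Qed.

Lemma rintegrable_measurable u : rintegrable u -> measurable_fun circle u.
Proof. by move=> /measurable_int /measurable_EFinP. Qed.

Lemma rintegrable_le_ae u v : measurable_fun circle u -> rintegrable v ->
  ae_circle (fun l => `|u l| <= v l) -> rintegrable u.
Proof.
move=> mu iv le; apply/integrableP; split; first exact/measurable_EFinP.
case/integrableP: (iv) => mv; apply: le_lt_trans.
apply: ae_ge0_le_integral => //=.
- by apply/measurable_EFinP; exact: measurableT_comp.
- by apply/measurable_EFinP; apply: measurableT_comp => //; exact/measurable_EFinP.
- move: le; apply: ae_circle_imp => l cl h.
  by rewrite lee_fin (le_trans h)// ler_norm.
Qed.

Lemma rintegrable_le u v : measurable_fun circle u -> rintegrable v ->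
  (forall l, circle l -> `|u l| <= v l) -> rintegrable u.
Proof. by move=> mu iv h; apply: rintegrable_le_ae mu iv (ae_circleW h). Qed.

Lemma rintegrable_cst (M : R) : rintegrable (cst M).
Proof.
have h : (lebesgue_measure (circle : set R) < +oo)%E by rewrite measure_circle ltry.
apply: measurable_bounded_integrable => //.
by exists `|M|; split => // x xM l _ /=; exact: ltW.
Qed.

Lemma rintegrable_bounded_ae u (M : R) : measurable_fun circle u ->
  ae_circle (fun l => `|u l| <= M) -> rintegrable u.
Proof. by move=> mu; apply: rintegrable_le_ae mu (rintegrable_cst M). Qed.

Lemma rintegrableD u v : rintegrable u -> rintegrable v ->
  rintegrable (fun l => u l + v l).
Proof. by move=> iu iv; exact: (integrableD (mu := @lebesgue_measure R) _ iu iv). Qed.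

Lemma rintegrableZ (k : R) u : rintegrable u -> rintegrable (fun l => k * u l).
Proof. by move=> iu; exact: (integrableZl (mu := @lebesgue_measure R) _ _ iu). Qed.

Lemma rintegrableN u : rintegrable u -> rintegrable (fun l => - u l).
Proof. by move=> iu; exact: (integrableN (mu := @lebesgue_measure R) iu). Qed.

Lemma rintegrableB u v : rintegrable u -> rintegrable v ->
  rintegrable (fun l => u l - v l).
Proof. by move=> iu iv; apply: rintegrableD => //; exact: rintegrableN. Qed.

Lemma rintegrable_abs u : rintegrable u -> rintegrable (fun l => `|u l|).
Proof. by move=> iu; exact: (integrable_abse (mu := @lebesgue_measure R) iu). Qed.

Lemma rintegrable_sum (I : Type) (r : seq I) (F : I -> R -> R) :
  (forall i, rintegrable (F i)) -> rintegrable (fun l => \sum_(i <- r) F i l).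
Proof.
move=> iF; elim: r => [|i r IH].
  by under eq_fun do rewrite big_nil; exact: (rintegrable_cst 0).
by under eq_fun do rewrite big_cons; exact: rintegrableD.
Qed.

Lemma rintegrableM_bounded u v (M : R) : measurable_fun circle v ->
  ae_circle (fun l => `|v l| <= M) -> rintegrable u ->
  rintegrable (fun l => v l * u l).
Proof.
move=> mv hv iu.
apply: (@rintegrable_le_ae _ (fun l => M * `|u l|)).
- by apply: measurable_funM => //; exact: rintegrable_measurable.
- by apply: rintegrableZ; exact: rintegrable_abs.
- by move: hv; apply: ae_circle_imp => l cl h; rewrite normrM ler_wpM2r.
Qed.

Lemma rintD u v : rintegrable u -> rintegrable v ->
  rint (fun l => u l + v l) = rint u + rint v.
Proof. exact: RintegralD. Qed.

Lemma rintB u v : rintegrable u -> rintegrable v ->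
  rint (fun l => u l - v l) = rint u - rint v.
Proof. exact: RintegralB. Qed.

Lemma rintZ (k : R) u : rintegrable u -> rint (fun l => k * u l) = k * rint u.
Proof. exact: RintegralZl. Qed.

Lemma rint_cst (k : R) : rint (cst k) = k * (2 * pi).
Proof.
rewrite /rint Rintegral_cst//; congr (_ * _).
exact: (congr1 fine measure_circle).
Qed.

Lemma rintN u : rintegrable u -> rint (fun l => - u l) = - rint u.
Proof.
move=> iu; rewrite -mulN1r -rintZ//; congr rint.
by apply/funext => l; rewrite mulN1r.
Qed.

Lemma rint_sum (I : Type) (r : seq I) (F : I -> R -> R) :
  (forall i, rintegrable (F i)) ->
  rint (fun l => \sum_(i <- r) F i l) = \sum_(i <- r) rint (F i).
Proof.
move=> iF; elim: r => [|i r IH].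
  by rewrite big_nil; under eq_fun do rewrite big_nil; rewrite rint_cst mul0r.
under eq_fun do rewrite big_cons.
by rewrite big_cons rintD ?IH//; exact: rintegrable_sum.
Qed.

Lemma rint_EFin u : rintegrable u ->
  (\int[@lebesgue_measure R]_(l in circle) (u l)%:E)%E = (rint u)%:E.
Proof. by move=> iu; rewrite /rint /Rintegral fineK// integrable_fin_num. Qed.

Lemma rint_ge0 u : (forall l, circle l -> 0 <= u l) -> 0 <= rint u.
Proof. by move=> u0; apply: Rintegral_ge0 => // l; exact: u0. Qed.

Lemma rint_abs u : rintegrable u -> `|rint u| <= rint (fun l => `|u l|).
Proof. by move=> iu; apply: le_normr_Rintegral. Qed.

Lemma rint_eq_ae u v : rintegrable u -> measurable_fun circle v ->
  ae_circle (fun l => u l = v l) -> rint u = rint v.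
Proof.
move=> iu mv h; rewrite /rint /Rintegral; congr fine.
apply: ae_eq_integral => //.
- exact: measurable_int iu.
- exact/measurable_EFinP.
- by move: h; apply: ae_circle_imp => l cl /= ->.
Qed.

Lemma rint_eq u v : (forall l, circle l -> u l = v l) -> rint u = rint v.
Proof. by move=> h; apply: eq_Rintegral => l; rewrite inE => /h. Qed.

(** Replacing [v] by the maximum of [u] and [v], which agrees with it almost everywhere, turns the
    comparison into a pointwise one. *)
Lemma rint_le_ae u v : rintegrable u -> rintegrable v ->
  ae_circle (fun l => u l <= v l) -> rint u <= rint v.
Proof.
move=> iu iv h.
have mm : measurable_fun circle (fun l => Num.max (u l) (v l)).
  by apply: measurable_maxr; exact: rintegrable_measurable.
have im : rintegrable (fun l => Num.max (u l) (v l)).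
  apply: (@rintegrable_le _ (fun l => `|u l| + `|v l|)) => //.
    by apply: rintegrableD; exact: rintegrable_abs.
  by move=> l _; rewrite /Num.max; case: ifP => _; rewrite ?lerDl ?lerDr.
rewrite (@rint_eq_ae v (fun l => Num.max (u l) (v l)))//; last first.
  by move: h; apply: ae_circle_imp => l _ /max_r.
by apply: le_Rintegral => // l _; rewrite le_max lexx.
Qed.

Lemma rint_le u v : rintegrable u -> rintegrable v ->
  (forall l, circle l -> u l <= v l) -> rint u <= rint v.
Proof. by move=> iu iv h; apply: rint_le_ae iu iv (ae_circleW h). Qed.

Lemma rintegrable_lty u : measurable_fun circle u ->
  (forall l, circle l -> 0 <= u l) ->
  (\int[@lebesgue_measure R]_(l in circle) (u l)%:E < +oo)%E -> rintegrable u.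
Proof.
move=> mu u0 h; apply/integrableP; split; first exact/measurable_EFinP.
apply: le_lt_trans h; rewrite le_eqVlt; apply/orP; left; apply/eqP.
by apply: eq_integral => l; rewrite inE => cl /=; rewrite ger0_norm// u0.
Qed.

Lemma rint_eq0_ae u : rintegrable u -> (forall l, circle l -> 0 <= u l) ->
  rint u <= 0 -> ae_circle (fun l => u l = 0).
Proof.
move=> iu u0 h.
have mc : measurable (circle : set (measurableTypeR R)) by exact: measurable_itv.
have [+ _] := @ae_eq_integral_abs _ _ _ (@lebesgue_measure R) _ mc
  _ (measurable_int _ iu).
move=> /(_ _)[].
  transitivity (\int[@lebesgue_measure R]_(l in circle) (u l)%:E)%E.
    by apply: eq_integral => l; rewrite inE => cl /=; rewrite ger0_norm// u0.
  rewrite rint_EFin//; congr EFin; apply/eqP.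
  by rewrite eq_le h rint_ge0.
move=> N [mN N0 hN]; exists N; split => // l /= hl.
by apply: hN => /= hc; apply: hl => cl; have /= [] := hc cl.
Qed.

End RealCircleIntegral.
#[global] Hint Resolve measurable_circle : core.

(** * Complex exponentials and the Fejer kernel *)

Section Exponentials.
Context {R : realType}.
Implicit Types (x y z : R).

Lemma expiD x y : expi (x + y) = expi x * expi y.
Proof.
by rewrite /expi cosD sinD; apply/eqP; rewrite eq_complex /=;
  apply/andP; split; apply/eqP; ring.
Qed.

Lemma expi0 : expi (0 : R) = 1.
Proof. by rewrite /expi cos0 sin0. Qed.

Lemma conjc_expi x : conjc (expi x) = expi (- x).
Proof. by rewrite /expi cosN sinN. Qed.

Lemma cabs_sqr (z : R[i]) : cabs z ^+ 2 = complex.Re z ^+ 2 + complex.Im z ^+ 2.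
Proof. by case: z => a b /=; rewrite /cabs /= sqr_sqrtr// addr_ge0// sqr_ge0. Qed.

Lemma cabs_ge0 (z : R[i]) : 0 <= cabs z.
Proof. by case: z => a b; exact: sqrtr_ge0. Qed.

Lemma cabsM (z w : R[i]) : cabs (z * w) = cabs z * cabs w.
Proof. exact: ComplexField.Normc.normcM. Qed.

Lemma cabsD (z w : R[i]) : cabs (z + w) <= cabs z + cabs w.
Proof. exact: le_normcD. Qed.

Lemma cabsN (z : R[i]) : cabs (- z) = cabs z.
Proof. exact: normcN. Qed.

Lemma cabs_conj (z : R[i]) : cabs (conjc z) = cabs z.
Proof. by case: z => a b; rewrite /cabs /= sqrrN. Qed.

Lemma cabs_real x : cabs x%:C = `|x|.
Proof. by rewrite /cabs /= expr0n addr0 sqrtr_sqr. Qed.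

Lemma cabs0 : cabs (0 : R[i]) = 0.
Proof. by rewrite cabs_real normr0. Qed.

Lemma cabs_expi x : cabs (expi x) = 1.
Proof. by rewrite /cabs /= cos2Dsin2 sqrtr1. Qed.

Lemma abs_Re_le (z : R[i]) : `|complex.Re z| <= cabs z.
Proof.
by case: z => a b; rewrite /cabs /= -sqrtr_sqr ler_sqrt ?addr_ge0 ?sqr_ge0// lerDl sqr_ge0.
Qed.

Lemma abs_Im_le (z : R[i]) : `|complex.Im z| <= cabs z.
Proof.
by case: z => a b; rewrite /cabs /= -sqrtr_sqr ler_sqrt ?addr_ge0 ?sqr_ge0// lerDr sqr_ge0.
Qed.

Lemma cabs_le_ReIm (z : R[i]) : cabs z <= `|complex.Re z| + `|complex.Im z|.
Proof.
rewrite -[leRHS]ger0_norm ?addr_ge0// -sqrtr_sqr /cabs.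
case: z => a b /=; rewrite ler_sqrt ?sqr_ge0//.
have := normr_ge0 a; have := normr_ge0 b.
rewrite -(real_normK (num_real a)) -(real_normK (num_real b)).
by nra.
Qed.

Lemma cabs_sum (I : Type) (r : seq I) (F : I -> R[i]) :
  cabs (\sum_(i <- r) F i) <= \sum_(i <- r) cabs (F i).
Proof.
elim: r => [|i r IH]; first by rewrite !big_nil cabs0.
by rewrite !big_cons (le_trans (cabsD _ _))// lerD2l.
Qed.

Lemma Re_sum (I : Type) (r : seq I) (P : pred I) (F : I -> R[i]) :
  complex.Re (\sum_(i <- r | P i) F i) = \sum_(i <- r | P i) complex.Re (F i).
Proof. exact: raddf_sum. Qed.

Lemma Im_sum (I : Type) (r : seq I) (P : pred I) (F : I -> R[i]) :
  complex.Im (\sum_(i <- r | P i) F i) = \sum_(i <- r | P i) complex.Im (F i).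
Proof. exact: raddf_sum. Qed.

Definition dirichlet (n : nat) x : R[i] := \sum_(j < n) expi (j%:R * x).

(** The Fejer kernel as a cosine polynomial: unlike the quotient of sines it needs no convention at
    multiples of 2 pi. It vanishes identically at [n = 0], hence the index [n.+1] wherever its mass
    matters. *)
Definition fejerK (n : nat) x : R :=
  n%:R^-1 * \sum_(j < n) \sum_(k < n) cos ((j%:R - k%:R) * x).

Lemma dirichlet_geom n x :
  (expi x - 1) * dirichlet n x = expi (n%:R * x) - 1.
Proof.
elim: n => [|n IH]; first by rewrite /dirichlet big_ord0 mulr0 mul0r expi0 subrr.
rewrite /dirichlet big_ord_recr /= mulrDr IH -natr1.
have -> : (n%:R + 1) * x = n%:R * x + x by ring.
by rewrite expiD; ring.
Qed.

(** Since cos((j - k) x) = cos jx cos kx + sin jx sin kx, the double sum is a sum of two squares.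
    Positivity of the kernel comes from this form. *)
Lemma fejerK_dirichlet n x : fejerK n x = n%:R^-1 * cabs (dirichlet n x) ^+ 2.
Proof.
congr (_ * _); rewrite cabs_sqr /dirichlet Re_sum Im_sum /= !expr2 !mulr_suml.
rewrite -big_split /=; apply: eq_bigr => j _.
rewrite !mulr_sumr -big_split /=; apply: eq_bigr => k _.
by rewrite mulrBl cosB.
Qed.

Lemma fejerK_ge0 n x : 0 <= fejerK n x.
Proof. by rewrite fejerK_dirichlet mulr_ge0// ?sqr_ge0// invr_ge0. Qed.

(* [(1 - cos x) |D_n x|^2 = 1 - cos (n x)] for the Dirichlet sum [D_n]. *)
Lemma fejerK_tail n x : fejerK n x * (1 - cos x) <= 2 / n%:R.
Proof.
rewrite fejerK_dirichlet -mulrA mulrC ler_wpM2r ?invr_ge0//.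
have h m : cabs (expi (m%:R * x) - 1) ^+ 2 = 2 - 2 * cos (m%:R * x).
  by rewrite cabs_sqr /= subr0; have := cos2Dsin2 (m%:R * x); lra.
have := congr1 (fun w : R[i] => cabs w ^+ 2) (dirichlet_geom n x).
rewrite h cabsM exprMn -{1}[x]mul1r (h 1%N) mul1r.
have := cos_geN1 (n%:R * x); lra.
Qed.

End Exponentials.

(** * Integrals of sines and cosines over one period *)

Section TrigIntegrals.
Context {R : realType}.
Implicit Types (c d : R) (u v : R -> R).

Lemma measurable_cos_affine c d :
  measurable_fun circle (fun t : R => cos (c * t + d)).
Proof.
apply: measurable_funTS; apply: continuous_measurable_fun => t.
apply: (@continuous_comp _ _ _ (fun t => c * t + d) cos); last exact: continuous_cos.
apply: cvgD; last exact: cvg_cst.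
by apply: cvgM; [exact: cvg_cst|exact: cvg_id].
Qed.

Lemma measurable_sin_affine c d :
  measurable_fun circle (fun t : R => sin (c * t + d)).
Proof.
apply: measurable_funTS; apply: continuous_measurable_fun => t.
apply: (@continuous_comp _ _ _ (fun t => c * t + d) sin); last exact: continuous_sin.
apply: cvgD; last exact: cvg_cst.
by apply: cvgM; [exact: cvg_cst|exact: cvg_id].
Qed.

Lemma abs_cos_le1 c : `|cos c| <= 1.
Proof. by rewrite ler_norml cos_geN1 cos_le1. Qed.

Lemma abs_sin_le1 c : `|sin c| <= 1.
Proof. by rewrite ler_norml sin_geN1 sin_le1. Qed.

Lemma rintegrable_cosM c d u : rintegrable u ->
  rintegrable (fun t => cos (c * t + d) * u t).
Proof.
apply: (@rintegrableM_bounded _ _ _ 1); first exact: measurable_cos_affine.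
by apply: ae_circleW => l _; exact: abs_cos_le1.
Qed.

Lemma rintegrable_sinM c d u : rintegrable u ->
  rintegrable (fun t => sin (c * t + d) * u t).
Proof.
apply: (@rintegrableM_bounded _ _ _ 1); first exact: measurable_sin_affine.
by apply: ae_circleW => l _; exact: abs_sin_le1.
Qed.

Lemma rintegrable_cos c : rintegrable (fun t => cos (c * t)).
Proof.
apply: (@rintegrable_bounded_ae _ _ 1).
  by under eq_fun do rewrite -[c * _]addr0; exact: measurable_cos_affine.
by apply: ae_circleW => l _; exact: abs_cos_le1.
Qed.

Lemma rintegrable_sin c : rintegrable (fun t => sin (c * t)).
Proof.
apply: (@rintegrable_bounded_ae _ _ 1).
  by under eq_fun do rewrite -[c * _]addr0; exact: measurable_sin_affine.
by apply: ae_circleW => l _; exact: abs_sin_le1.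
Qed.

Lemma rint_FTC (F g : R -> R) : continuous g ->
  (forall x : R, is_derive x (1 : R) F (g x)) -> rint g = F pi - F (- pi).
Proof.
move=> cg dF; have p0 := @pi_gt0 R.
have cF : continuous F.
  move=> x; apply: differentiable_continuous; apply/derivable1_diffP.
  by have [] := dF x.
rewrite /rint /Rintegral (@continuous_FTC2 _ g F)//; first by lra.
- exact: continuous_subspaceT.
- split.
  + by move=> x _; have [] := dF x.
  + by apply: cvg_at_right_filter; exact: cF.
  + by apply: cvg_at_left_filter; exact: cF.
- by move=> x _; rewrite derive1E; apply: derive_val.
Qed.

Lemma sin_natpi (n : nat) : sin (n%:R * pi) = 0 :> R.
Proof.
elim: n => [|n IH]; first by rewrite mul0r sin0.
by rewrite -natr1 mulrDl mul1r sinDpi IH oppr0.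
Qed.

Lemma rint_cos (j k : nat) :
  rint (fun t : R => cos ((j%:R - k%:R) * t)) = if j == k then 2 * pi else 0.
Proof.
have [<-|njk] := eqVneq j k.
  under eq_fun do rewrite subrr mul0r cos0.
  by rewrite (rint_cst 1) mul1r.
set c : R := _ - _.
have c0 : c != 0 by rewrite subr_eq0 eqr_nat.
have s0 : sin (c * pi) = 0 by rewrite mulrBl sinB !sin_natpi mul0r mulr0 subrr.
have dF x : is_derive x (1 : R) (fun t => c^-1 * sin (c * t)) (cos (c * x)).
  apply: is_derive_eq.
  by rewrite /GRing.scale /= ; field.
have cc : continuous (fun t => cos (c * t)).
  move=> t; apply: (@continuous_comp _ _ _ (fun t => c * t) cos).
    by apply: cvgM; [exact: cvg_cst|exact: cvg_id].
  exact: continuous_cos.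
by rewrite (rint_FTC cc dF) mulrN sinN s0 oppr0 mulr0 subrr.
Qed.

(** The antiderivative is even, so the endpoint values cancel for every real [c], integer or not. *)
Lemma rint_sin c : rint (fun t : R => sin (c * t)) = 0.
Proof.
have [->|c0] := eqVneq c 0.
  by under eq_fun do rewrite mul0r sin0; rewrite (rint_cst 0) mul0r.
have dF x : is_derive x (1 : R) (fun t => - c^-1 * cos (c * t)) (sin (c * x)).
  apply: is_derive_eq.
  by rewrite /GRing.scale /= ; field.
have cc : continuous (fun t => sin (c * t)).
  move=> t; apply: (@continuous_comp _ _ _ (fun t => c * t) sin).
    by apply: cvgM; [exact: cvg_cst|exact: cvg_id].
  exact: continuous_sin.
by rewrite (rint_FTC cc dF) mulrN cosN subrr.
Qed.

End TrigIntegrals.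

(** * Fejer means: mass, positivity and contraction *)

Section Fejer.
Context {R : realType}.
Implicit Types (u v : R -> R) (x M : R).

(** The Cesaro mean of the Fourier series of [u]. Only values of [u] on [circle] enter, so [u] is in
    effect continued periodically. *)
Definition fejer n u x : R :=
  (2 * pi)^-1 * rint (fun t => fejerK n (x - t) * u t).

Lemma twopi_gt0 : 0 < 2 * pi :> R.
Proof. by rewrite mulr_gt0// pi_gt0. Qed.

Lemma fejerK_expand n x t : fejerK n (x - t) =
  \sum_(j < n) \sum_(k < n) (n%:R^-1 * (cos ((j%:R - k%:R) * x) *
     cos ((j%:R - k%:R) * t) + sin ((j%:R - k%:R) * x) * sin ((j%:R - k%:R) * t))).
Proof.
rewrite /fejerK mulr_sumr; apply: eq_bigr => j _.
rewrite mulr_sumr; apply: eq_bigr => k _.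
by rewrite mulrBr cosB.
Qed.

Lemma rintegrable_cosZ (c : R) u : rintegrable u ->
  rintegrable (fun t => cos (c * t) * u t).
Proof. by move=> iu; under eq_fun do rewrite -[c * _]addr0; exact: rintegrable_cosM. Qed.

Lemma rintegrable_sinZ (c : R) u : rintegrable u ->
  rintegrable (fun t => sin (c * t) * u t).
Proof. by move=> iu; under eq_fun do rewrite -[c * _]addr0; exact: rintegrable_sinM. Qed.

Let term n x u (j k : nat) (t : R) : R :=
  n%:R^-1 * (cos ((j%:R - k%:R) * x) * (cos ((j%:R - k%:R) * t) * u t) +
             sin ((j%:R - k%:R) * x) * (sin ((j%:R - k%:R) * t) * u t)).

Let rintegrable_term n x u j k : rintegrable u -> rintegrable (term n x u j k).
Proof.
move=> iu; apply/rintegrableZ/rintegrableD; apply: rintegrableZ.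
  exact: rintegrable_cosZ.
exact: rintegrable_sinZ.
Qed.

Let fejerK_term n x u t :
  fejerK n (x - t) * u t = \sum_(j < n) \sum_(k < n) term n x u j k t.
Proof.
rewrite fejerK_expand mulr_suml; apply: eq_bigr => j _.
rewrite mulr_suml; apply: eq_bigr => k _; rewrite /term; ring.
Qed.

Lemma rintegrable_fejerK n x u : rintegrable u ->
  rintegrable (fun t => fejerK n (x - t) * u t).
Proof.
move=> iu; under eq_fun do rewrite fejerK_term.
by apply: rintegrable_sum => j; apply: rintegrable_sum => k; exact: rintegrable_term.
Qed.

Lemma fejer_expand n u x : rintegrable u -> fejer n u x =
  \sum_(j < n) \sum_(k < n) ((2 * pi)^-1 * (n%:R^-1 *
    (cos ((j%:R - k%:R) * x) * rint (fun t => cos ((j%:R - k%:R) * t) * u t) +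
     sin ((j%:R - k%:R) * x) * rint (fun t => sin ((j%:R - k%:R) * t) * u t)))).
Proof.
move=> iu; rewrite /fejer; under eq_fun do rewrite fejerK_term.
rewrite rint_sum; last first.
  by move=> j; apply: rintegrable_sum => k; exact: rintegrable_term.
rewrite mulr_sumr; apply: eq_bigr => j _.
rewrite rint_sum; last by move=> k; exact: rintegrable_term.
rewrite mulr_sumr; apply: eq_bigr => k _.
have ic := rintegrable_cosZ (j%:R - k%:R) iu.
have is_ := rintegrable_sinZ (j%:R - k%:R) iu.
rewrite /term rintZ; last by apply: rintegrableD; apply: rintegrableZ.
by rewrite rintD ?rintZ//; apply: rintegrableZ.
Qed.

Lemma sum_diag n (c : R) :
  \sum_(j < n) \sum_(k < n) (if (j : nat) == k then c else 0) = n%:R * c.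
Proof.
under eq_bigr => j _.
  rewrite (bigD1 j)//= eqxx big1 ?addr0; last first.
    by move=> k kj; rewrite ifF//; apply/negbTE; rewrite eq_sym.
  over.
by rewrite sumr_const card_ord mulr_natl.
Qed.

Lemma fejer1 n x : fejer n.+1 (cst 1) x = 1.
Proof.
rewrite fejer_expand; last exact: rintegrable_cst.
rewrite -[RHS](@mulfV _ n.+1%:R)// -[RHS]sum_diag.
apply: eq_bigr => j _; apply: eq_bigr => k _.
rewrite (@rint_eq _ _ (fun t => cos ((j%:R - k%:R) * t))); last by move=> t _ /=; ring.
rewrite (@rint_eq _ (fun t => sin _ * _) (fun t => sin ((j%:R - k%:R) * t))); last first.
  by move=> t _ /=; ring.
rewrite rint_cos rint_sin mulr0 addr0.
case: eqP => [->|_]; last by rewrite !mulr0.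
rewrite subrr mul0r cos0 mul1r mulrCA mulVf ?mulr1//.
by rewrite gt_eqF// twopi_gt0.
Qed.

Let fterm n u (j k : nat) x : R := (2 * pi)^-1 * (n%:R^-1 *
    (rint (fun t => cos ((j%:R - k%:R) * t) * u t) * cos ((j%:R - k%:R) * x) +
     rint (fun t => sin ((j%:R - k%:R) * t) * u t) * sin ((j%:R - k%:R) * x))).

Let rintegrable_fterm n u j k : rintegrable (fterm n u j k).
Proof.
do 2 apply: rintegrableZ; apply: rintegrableD; apply: rintegrableZ.
  exact: rintegrable_cos.
exact: rintegrable_sin.
Qed.

Let fejer_fterm n u : rintegrable u ->
  fejer n u = fun x => \sum_(j < n) \sum_(k < n) fterm n u j k x.
Proof.
move=> iu; apply/funext => x; rewrite fejer_expand//.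
apply: eq_bigr => j _; apply: eq_bigr => k _.
by rewrite /fterm; ring.
Qed.

Lemma rintegrable_fejer n u : rintegrable u -> rintegrable (fejer n u).
Proof.
move=> iu; rewrite fejer_fterm//.
by apply: rintegrable_sum => j; apply: rintegrable_sum => k; exact: rintegrable_fterm.
Qed.

(** Only the diagonal terms of the double sum survive integration; there are [n.+1] of them, each
    contributing the integral of [u] divided by [n.+1]. *)
Lemma rint_fejer n u : rintegrable u -> rint (fejer n.+1 u) = rint u.
Proof.
move=> iu; rewrite fejer_fterm// rint_sum; last first.
  by move=> j; apply: rintegrable_sum => k; exact: rintegrable_fterm.
rewrite -[RHS](@mulVKf _ n.+1%:R)// -[RHS]sum_diag.
apply: eq_bigr => j _; rewrite rint_sum; last by move=> k; exact: rintegrable_fterm.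
apply: eq_bigr => k _.
have ic := @rintegrable_cos R (j%:R - k%:R).
have is_ := @rintegrable_sin R (j%:R - k%:R).
rewrite /fterm rintZ; last by apply/rintegrableZ/rintegrableD; apply: rintegrableZ.
rewrite rintZ; last by apply: rintegrableD; apply: rintegrableZ.
rewrite rintD ?rintZ//; [|exact: rintegrableZ..].
rewrite rint_cos rint_sin mulr0 addr0.
case: eqP => [->|_]; last by rewrite !mulr0.
rewrite (@rint_eq _ _ u); last by move=> t _; rewrite subrr mul0r cos0 mul1r.
by rewrite mulrCA; congr (_ * _); rewrite mulrC mulfK// gt_eqF// twopi_gt0.
Qed.

Lemma fejerB n u v x : rintegrable u -> rintegrable v ->
  fejer n (fun t => u t - v t) x = fejer n u x - fejer n v x.
Proof.
move=> iu iv; rewrite /fejer -mulrBr -rintB; [|exact: rintegrable_fejerK..].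
by congr (_ * rint _); apply/funext => t; rewrite mulrBr.
Qed.

Lemma fejer_le n u v x : rintegrable u -> rintegrable v ->
  ae_circle (fun t => u t <= v t) -> fejer n u x <= fejer n v x.
Proof.
move=> iu iv h; rewrite ler_wpM2l ?invr_ge0 ?(ltW twopi_gt0)//.
apply: rint_le_ae; [exact: rintegrable_fejerK..|].
by move: h; apply: ae_circle_imp => t _ h; rewrite ler_wpM2l// fejerK_ge0.
Qed.

Lemma fejer_abs n u x : rintegrable u ->
  `|fejer n u x| <= fejer n (fun t => `|u t|) x.
Proof.
move=> iu; rewrite /fejer normrM ger0_norm ?invr_ge0 ?(ltW twopi_gt0)//.
rewrite ler_wpM2l ?invr_ge0 ?(ltW twopi_gt0)//.
apply: (le_trans (rint_abs (rintegrable_fejerK n x iu))).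
rewrite le_eqVlt; apply/orP; left; apply/eqP/rint_eq => t _.
by rewrite normrM ger0_norm// fejerK_ge0.
Qed.

Lemma fejer_cst n M x : fejer n.+1 (cst M) x = M.
Proof.
rewrite -[RHS]mulr1 -[X in M * X](fejer1 n x) /fejer mulrCA.
rewrite -[X in _ = _ * X]rintZ; last exact/rintegrable_fejerK/rintegrable_cst.
by congr (_ * rint _); apply/funext => t /=; rewrite mulr1 mulrC.
Qed.

Lemma fejer_bounded n u x M : rintegrable u -> ae_circle (fun t => `|u t| <= M) ->
  `|fejer n.+1 u x| <= M.
Proof.
move=> iu h; rewrite -(fejer_cst n M x); apply: le_trans (fejer_abs _ _ iu) _.
by apply: fejer_le => //; [exact: rintegrable_abs|exact: rintegrable_cst].
Qed.

(** The mean of [u] is dominated by the mean of |u|, whose integral is that of |u|. Conservation of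
    the integral thus does the work of Fubini's theorem for the convolution. *)
Lemma fejer_contraction n u : rintegrable u ->
  rint (fun x => `|fejer n.+1 u x|) <= rint (fun x => `|u x|).
Proof.
move=> iu; have ia := rintegrable_abs iu; rewrite -(rint_fejer n ia).
apply: rint_le; [exact/rintegrable_abs/rintegrable_fejer|exact: rintegrable_fejer|].
by move=> x _; exact: fejer_abs.
Qed.

End Fejer.

(** * Pointwise convergence of Fejer means of continuous functions *)

Section FejerConvergence.
Context {R : realType}.
Implicit Types (u v : R -> R) (x M e d : R).

(** The difference of two points of the circle reaches 2 pi in modulus, so staying away from 0 is
    not enough: the upper bound keeps it away from the next zero of 1 - cos as well. *)
Lemma cos_away d x : 0 < d -> d <= pi -> d <= `|x| -> `|x| <= 2 * pi - d ->
  cos x <= cos d.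
Proof.
move=> d0 dpi dx xd.
have -> : cos x = cos `|x|.
  by have [|] := ger0P x => // _; rewrite cosN.
set y := `|x| in dx xd *.
have mono s t : 0 <= s <= pi -> 0 <= t <= pi -> s <= t -> cos t <= cos s.
  by move=> hs ht st; rewrite leNgt ltr_cos ?in_itv//= -leNgt.
have [yp|yp] := leP y pi.
  by apply: mono => //; apply/andP; split; lra.
have -> : cos y = cos (pi *+ 2 - y).
  by rewrite addrC cosD2pi cosN.
by apply: mono; rewrite ?mulr2n; [apply/andP; split; lra|apply/andP; split; lra|lra].
Qed.

(** The endpoints are excluded because [v] need not agree at -pi and pi, and its periodic
    continuation may jump there. *)
Lemma fejer_pointwise v M x : continuous v -> (forall t, circle t -> `|v t| <= M) ->
  - pi < x < pi -> forall e, 0 < e ->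
  \forall n \near \oo, `|fejer n.+1 v x - v x| <= e.
Proof.
move=> cv vM /andP[xl xr] e e0.
have cx : circle x by rewrite /circle /= in_itv /=; apply/andP; split; lra.
have M0 : 0 <= M := le_trans (normr_ge0 _) (vM _ cx).
have iv : rintegrable v.
  apply: (@rintegrable_bounded_ae _ _ M); last exact: ae_circleW.
  by apply: measurable_funTS; exact: continuous_measurable_fun.
have e2 : 0 < e / 2 by lra.
have [d1 /= d10 hd1] : exists2 d : R, 0 < d & forall t, `|x - t| < d -> `|v x - v t| <= e / 2.
  have /cvgrPdist_le /(_ _ e2) := cv x.
  by move=> /nbhs_ballP[d /= d0 h]; exists d => // t ht; apply: h.
(* The first entry comes from continuity at [x]; the second ensures |x - t| <= |x| + pi <= 2 pi - d
   for every [t] on the circle. *)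
set d : R := Num.min d1 (pi - `|x|).
have xp : `|x| < pi by rewrite ltr_norml xl xr.
have d0 : 0 < d by rewrite lt_min d10 subr_gt0.
have dp : d <= pi - `|x| by rewrite ge_min lexx orbT.
have dd1 : d <= d1 by rewrite ge_min lexx.
have x0 := normr_ge0 x.
have p0 := @pi_gt0 R.
clearbody d.
have c1 : cos d < 1.
  rewrite -[X in _ < X](@cos0 R) ltr_cos ?in_itv//=; apply/andP; split; clear hd1 vM cv; lra.
set k := 1 - cos d; have k0 : 0 < k by rewrite subr_gt0.
(* Near [x] continuity bounds the oscillation by e / 2; elsewhere it is at most 2 M and the kernel
   is at most 2 / n.+1 divided by [k]. Adding both bounds gives one estimate valid everywhere, which
   integrates at once because the kernel has mean 1. *)
have key n t : circle t ->
    fejerK n.+1 (x - t) * `|v t - v x| <=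
      e / 2 * fejerK n.+1 (x - t) + (2 * M / k * (2 / n.+1%:R)).
  move=> ct; have K0 := fejerK_ge0 n.+1 (x - t).
  have q0 : 0 <= 2 * M / k * (2 / n.+1%:R).
    by apply: mulr_ge0; [apply: divr_ge0; lra|apply: divr_ge0].
  have [h|h] := ltP `|x - t| d1.
    apply: (@le_trans _ _ (e / 2 * fejerK n.+1 (x - t))); last by rewrite lerDl.
    by rewrite distrC mulrC ler_wpM2r// hd1.
  have hc : cos (x - t) <= cos d.
    move: ct; rewrite /circle /= in_itv /= => /andP[t1 t2].
    have ht : `|t| <= pi by rewrite ler_norml; apply/andP; split; lra.
    apply: cos_away => //; [lra|lra|].
    by have := ler_normB x t; lra.
  have h1 := fejerK_tail n.+1 (x - t).
  have h2 : fejerK n.+1 (x - t) * k <= 2 / n.+1%:R.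
    by apply: le_trans h1; rewrite ler_wpM2l// /k; lra.
  have h3 : `|v t - v x| <= 2 * M.
    by have := ler_normB (v t) (v x); have := vM _ ct; have := vM _ cx; lra.
  have h4 : fejerK n.+1 (x - t) <= (2 / n.+1%:R) / k by rewrite ler_pdivlMr.
  have h5 : fejerK n.+1 (x - t) * `|v t - v x| <= (2 / n.+1%:R) / k * (2 * M).
    by apply: ler_pM.
  have -> : 2 * M / k * (2 / n.+1%:R) = (2 / n.+1%:R) / k * (2 * M) by ring.
  by apply: le_trans h5 _; rewrite lerDr mulr_ge0// ltW.
have bound n : `|fejer n.+1 v x - v x| <= e / 2 + 2 * M / k * (2 / n.+1%:R).
  have ic := @rintegrable_cst R (v x).
  have ivx : rintegrable (fun t => v t - v x) by exact: rintegrableB iv ic.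
  rewrite -[X in _ - X](fejer_cst n (v x) x) -fejerB//.
  apply: (le_trans (fejer_abs _ _ ivx)).
  rewrite /fejer -ler_pdivlMl ?invr_gt0 ?twopi_gt0// invrK.
  set q := 2 * M / k * _.
  have iK : rintegrable (fun t => fejerK n.+1 (x - t)).
    have := rintegrable_fejerK n.+1 x (@rintegrable_cst R 1).
    by congr rintegrable; apply/funext => t /=; rewrite mulr1.
  have -> : 2 * pi * (e / 2 + q) = rint (fun t => e / 2 * fejerK n.+1 (x - t) + q).
    rewrite rintD; [|exact: rintegrableZ|exact: rintegrable_cst].
    rewrite rint_cst rintZ//.
    have := fejer1 n x; rewrite /fejer (@rint_eq _ _ (fun t => fejerK n.+1 (x - t))).
      move=> h; rewrite mulrDr [q * _]mulrC; congr (_ + _).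
      rewrite mulrC; congr (_ * _).
      have tp : 2 * pi != 0 :> R by rewrite gt_eqF// twopi_gt0.
      by apply: (mulfI (invr_neq0 tp)); rewrite h mulVf.
    by move=> t _ /=; rewrite mulr1.
  apply: rint_le.
  - by apply: rintegrable_fejerK; exact: rintegrable_abs.
  - by apply: rintegrableD; [exact: rintegrableZ|exact: rintegrable_cst].
  - exact: key.
have [N _ hN] := nbhs_infty_ger (2 * M / k * 2 / (e / 2)).
exists N => // n Nn; apply: le_trans (bound n) _.
have : 2 * M / k * 2 / (e / 2) <= n.+1%:R by apply: le_trans (hN _ Nn) _; rewrite ler_nat.
rewrite ler_pdivrMr// => h.
suff : 2 * M / k * (2 / n.+1%:R) <= e / 2.
  by move=> hq; rewrite [leRHS]splitr lerD2l.
by rewrite mulrA ler_pdivrMr// (le_trans h)// mulrC.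
Qed.

End FejerConvergence.

(** * Convergence of Fejer means in L1 *)

Section FejerL1.
Context {R : realType}.
Implicit Types (u v : R -> R) (x M e d : R).

Lemma fejer_L1_continuous v : continuous v -> forall e, 0 < e ->
  \forall n \near \oo, rint (fun x => `|fejer n.+1 v x - v x|) <= e.
Proof.
move=> cv e e0.
have [M vM] : exists M, forall t, circle t -> `|v t| <= M.
  have cc : compact (circle : set R) by exact: segment_compact.
  have cw : {within circle, continuous v} by exact: continuous_subspaceT.
  have /compact_bounded[M [_ hM]] := continuous_compact cw cc.
  exists (`|M| + 1) => t ct; apply: (hM (`|M| + 1)); last by exists t.
  by rewrite (le_lt_trans (ler_norm _))// ltrDl.
have mv : measurable_fun circle v.
  by apply: measurable_funTS; exact: continuous_measurable_fun.
have iv : rintegrable v.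
  by apply: (@rintegrable_bounded_ae _ _ M) => //; exact: ae_circleW.
have iF n := rintegrable_fejer n.+1 iv.
(* Pointwise convergence is known only at interior points; the two endpoints form a null set. *)
have ae_int : ae_circle (fun x : R => - pi < x < pi).
  have : lebesgue_measure.-negligible ([set - pi] `|` [set pi] : set R).
    by apply: negligibleU; [exists [set - pi]|exists [set pi]]; split => //;
      exact: lebesgue_measure_set1.
  apply: negligibleS => x /= /not_implyP[]; rewrite /circle /= in_itv /=.
  move=> /andP[]; rewrite !le_eqVlt => /predU1P[->|->]; [by left|].
  by move=> /predU1P[->|->]//; right.
have [||_ + _] := @dominated_convergence _ _ _ (@lebesgue_measure R) _ measurable_circle
  (fun n x => (fejer n.+1 v x)%:E) (EFin \o v) (EFin \o cst M)
  (fun n => measurable_int _ (iF n)) (measurable_int _ iv) _ (rintegrable_cst M) _.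
- move: ae_int; apply: ae_circle_imp => x _ hx.
  apply/fine_cvgP; split; first exact: nearW.
  apply/cvgrPdist_le => d d0; have := fejer_pointwise cv vM hx d0.
  by apply: filterS => n; rewrite distrC.
- apply: aeW => x n _ /=; rewrite lee_fin.
  by apply: fejer_bounded => //; exact: ae_circleW.
have iD n : rintegrable (fun x => `|fejer n.+1 v x - v x|).
  exact/rintegrable_abs/rintegrableB.
under eq_fun do rewrite /= (rint_EFin (iD _)).
move=> /fine_cvgP[_] /cvgrPdist_le /(_ _ e0); apply: filterS => n /=.
by rewrite sub0r normrN ger0_norm// rint_ge0.
Qed.

(** Continuous functions are dense in L1, and the contraction property carries the approximation
    error over to the Fejer means. *)
Lemma fejer_L1 u : rintegrable u -> forall e, 0 < e ->
  \forall n \near \oo, rint (fun x => `|fejer n.+1 u x - u x|) <= e.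
Proof.
move=> iu e e0; have e3 : 0 < e / 3 by lra.
have fin : (lebesgue_measure (circle : set R) < +oo)%E by rewrite measure_circle ltry.
have [g [cg ig]] := approximation_continuous_integrable measurable_circle fin iu.
have iD n : rintegrable (fun x => `|u x - g n x|).
  by apply/rintegrable_abs/rintegrableB => //; exact: ig.
under eq_fun do rewrite /= (rint_EFin (iD _)).
move=> /fine_cvgP[_] /cvgrPdist_le /(_ _ e3)[N _ /(_ N (leqnn N))] /=.
rewrite sub0r normrN ger0_norm ?rint_ge0// => hN.
have {cg} cg := cg N; have {ig} ig := ig N; set v := g N in hN cg ig.
have iuv : rintegrable (fun x => u x - v x) by exact: rintegrableB.
have := fejer_L1_continuous cg e3; apply: filterS => n hn.
have h1 := fejer_contraction n iuv.
have i1 : rintegrable (fun x => `|fejer n.+1 (fun t => u t - v t) x|).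
  exact/rintegrable_abs/rintegrable_fejer.
have i2 : rintegrable (fun x => `|fejer n.+1 v x - v x|).
  by apply/rintegrable_abs/rintegrableB => //; exact: rintegrable_fejer.
have i3 : rintegrable (fun x => `|u x - v x|) by exact: rintegrable_abs.
have i4 : rintegrable (fun x => `|fejer n.+1 u x - u x|).
  by apply/rintegrable_abs/rintegrableB => //; exact: rintegrable_fejer.
apply: (@le_trans _ _ (rint (fun x => `|fejer n.+1 (fun t => u t - v t) x|
   + `|fejer n.+1 v x - v x| + `|u x - v x|))); last first.
  by rewrite !rintD//; [lra|exact: rintegrableD].
apply: rint_le => //; first by do 2 apply: rintegrableD => //.
move=> x _; rewrite fejerB//.
set a := fejer _ u x; set b := fejer _ v x.
rewrite [a - u x](_ : _ = (a - b) + (b - v x) + (v x - u x)); last by ring.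
by rewrite [`|u x - _|]distrC; do 2 (apply: le_trans (ler_normD _ _) _; rewrite ?lerD2r//).
Qed.

End FejerL1.

(** * Integrals of complex functions over the circle *)

Section ComplexCircleIntegral.
Context {R : realType}.
Implicit Types (h k : R -> R[i]) (u v : R -> R) (z : R[i]).

Definition cintegrable h : Prop :=
  rintegrable (fun l => complex.Re (h l)) /\ rintegrable (fun l => complex.Im (h l)).

Lemma complexP z w : complex.Re z = complex.Re w -> complex.Im z = complex.Im w -> z = w.
Proof. by case: z w => a b [c d] /= -> ->. Qed.

Lemma Re_mulc z w : complex.Re (z * w) =
  complex.Re z * complex.Re w - complex.Im z * complex.Im w.
Proof. by case: z w => a b [c d]. Qed.

Lemma Im_mulc z w : complex.Im (z * w) =
  complex.Re z * complex.Im w + complex.Im z * complex.Re w.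
Proof. by case: z w => a b [c d]. Qed.

Lemma ReD z w : complex.Re (z + w) = complex.Re z + complex.Re w.
Proof. by case: z w => a b [c d]. Qed.

Lemma ImD z w : complex.Im (z + w) = complex.Im z + complex.Im w.
Proof. by case: z w => a b [c d]. Qed.

Lemma ReN z : complex.Re (- z) = - complex.Re z.
Proof. by case: z. Qed.

Lemma ImN z : complex.Im (- z) = - complex.Im z.
Proof. by case: z. Qed.

Lemma Re_conjc z : complex.Re (conjc z) = complex.Re z.
Proof. by case: z. Qed.

Lemma Im_conjc z : complex.Im (conjc z) = - complex.Im z.
Proof. by case: z. Qed.

Lemma conjcM z w : conjc (z * w) = conjc z * conjc w.
Proof. exact: rmorphM. Qed.

Lemma conjc_sum (I : Type) (r : seq I) (F : I -> R[i]) :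
  conjc (\sum_(i <- r) F i) = \sum_(i <- r) conjc (F i).
Proof. exact: rmorph_sum. Qed.

Lemma mulc_conj z : z * conjc z = (cabs z ^+ 2)%:C.
Proof.
by apply: complexP; rewrite ?Re_mulc ?Im_mulc Re_conjc Im_conjc /= ?cabs_sqr; ring.
Qed.

Lemma real_complexM (x y : R) : (x * y)%:C = x%:C * y%:C.
Proof. exact: rmorphM. Qed.

Lemma cmeasurableD h k : cmeasurable h -> cmeasurable k ->
  cmeasurable (fun l => h l + k l).
Proof.
move=> [h1 h2] [k1 k2]; split.
  by under eq_fun do rewrite ReD; exact: measurable_funD.
by under eq_fun do rewrite ImD; exact: measurable_funD.
Qed.

Lemma cmeasurableN h : cmeasurable h -> cmeasurable (fun l => - h l).
Proof.
move=> [h1 h2]; split.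
  by under eq_fun do rewrite ReN; exact: measurableT_comp.
by under eq_fun do rewrite ImN; exact: measurableT_comp.
Qed.

Lemma cmeasurableB h k : cmeasurable h -> cmeasurable k ->
  cmeasurable (fun l => h l - k l).
Proof. by move=> mh mk; apply: cmeasurableD => //; exact: cmeasurableN. Qed.

Lemma cmeasurableM h k : cmeasurable h -> cmeasurable k ->
  cmeasurable (fun l => h l * k l).
Proof.
move=> [h1 h2] [k1 k2]; split.
  by under eq_fun do rewrite Re_mulc; apply: measurable_funB; exact: measurable_funM.
by under eq_fun do rewrite Im_mulc; apply: measurable_funD; exact: measurable_funM.
Qed.

Lemma cmeasurable_conj h : cmeasurable h -> cmeasurable (fun l => conjc (h l)).
Proof.
move=> [h1 h2]; split.
  by under eq_fun do rewrite Re_conjc.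
by under eq_fun do rewrite Im_conjc; exact: measurableT_comp.
Qed.

Lemma cmeasurable_real u : measurable_fun circle u -> cmeasurable (fun l => (u l)%:C).
Proof. by move=> mu; split => //=. Qed.

Lemma cmeasurable_cst z : cmeasurable (fun=> z).
Proof. by split => /=. Qed.

Lemma cmeasurable_expi (c : R) : cmeasurable (fun l => expi (c * l)).
Proof.
split => /=; under eq_fun do rewrite -[c * _]addr0.
  exact: measurable_cos_affine.
exact: measurable_sin_affine.
Qed.

Lemma measurable_cabs_sqr h : cmeasurable h ->
  measurable_fun circle (fun l => cabs (h l) ^+ 2).
Proof.
move=> [h1 h2]; under eq_fun do rewrite cabs_sqr !expr2.
by apply: measurable_funD; exact: measurable_funM.
Qed.

Lemma measurable_cabs h : cmeasurable h -> measurable_fun circle (fun l => cabs (h l)).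
Proof.
move=> /measurable_cabs_sqr mh.
rewrite (_ : (fun l => _) = Num.sqrt \o (fun l => cabs (h l) ^+ 2)); last first.
  by apply/funext => l /=; rewrite sqrtr_sqr ger0_norm// cabs_ge0.
apply: measurableT_comp => //; apply: continuous_measurable_fun.
exact: sqrt_continuous.
Qed.

Lemma cintegrable_measurable h : cintegrable h -> cmeasurable h.
Proof. by move=> [h1 h2]; split; exact: rintegrable_measurable. Qed.

Lemma cintegrable_le_ae h v : cmeasurable h -> rintegrable v ->
  ae_circle (fun l => cabs (h l) <= v l) -> cintegrable h.
Proof.
move=> [h1 h2] iv hv; split; apply: rintegrable_le_ae iv _ => //;
  move: hv; apply: ae_circle_imp => l _; apply: le_trans.
  exact: abs_Re_le.
exact: abs_Im_le.
Qed.

Lemma cintegrable_le h v : cmeasurable h -> rintegrable v ->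
  (forall l, circle l -> cabs (h l) <= v l) -> cintegrable h.
Proof. by move=> mh iv hv; apply: cintegrable_le_ae mh iv (ae_circleW hv). Qed.

Lemma cintegrable_bounded_ae h (M : R) : cmeasurable h ->
  ae_circle (fun l => cabs (h l) <= M) -> cintegrable h.
Proof. by move=> mh; apply: cintegrable_le_ae mh (rintegrable_cst M). Qed.

Lemma cintegrable_cabs h : cintegrable h -> rintegrable (fun l => cabs (h l)).
Proof.
move=> ih; have [h1 h2] := ih.
apply: (@rintegrable_le _ _ (fun l => `|complex.Re (h l)| + `|complex.Im (h l)|)).
- by apply: measurable_cabs; exact: cintegrable_measurable.
- by apply: rintegrableD; exact: rintegrable_abs.
- by move=> l _; rewrite ger0_norm ?cabs_ge0//; exact: cabs_le_ReIm.
Qed.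

Lemma cintegrableM_bounded h k (M : R) : cmeasurable h ->
  ae_circle (fun l => cabs (h l) <= M) -> cintegrable k ->
  cintegrable (fun l => h l * k l).
Proof.
move=> mh hM ik.
apply: (@cintegrable_le_ae _ (fun l => M * cabs (k l))).
- by apply: cmeasurableM => //; exact: cintegrable_measurable.
- by apply: rintegrableZ; exact: cintegrable_cabs.
- by move: hM; apply: ae_circle_imp => l _ hl; rewrite cabsM ler_wpM2r// cabs_ge0.
Qed.

Lemma cintegrable_expiM (c : R) h : cintegrable h ->
  cintegrable (fun l => expi (c * l) * h l).
Proof.
apply: (@cintegrableM_bounded _ _ 1); first exact: cmeasurable_expi.
by apply: ae_circleW => l _; rewrite cabs_expi.
Qed.

Lemma cintegrable_real u : rintegrable u -> cintegrable (fun l => (u l)%:C).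
Proof. by move=> iu; split => //=; exact: (rintegrable_cst 0). Qed.

Lemma cintegrableD h k : cintegrable h -> cintegrable k ->
  cintegrable (fun l => h l + k l).
Proof.
move=> [h1 h2] [k1 k2]; split.
  by under eq_fun do rewrite ReD; exact: rintegrableD.
by under eq_fun do rewrite ImD; exact: rintegrableD.
Qed.

Lemma cintegrableZ z h : cintegrable h -> cintegrable (fun l => z * h l).
Proof.
apply: (@cintegrableM_bounded _ _ (cabs z)); first exact: cmeasurable_cst.
exact: ae_circleW.
Qed.

Lemma cintegrableN h : cintegrable h -> cintegrable (fun l => - h l).
Proof. by move=> ih; under eq_fun do rewrite -mulN1r; exact: cintegrableZ. Qed.

Lemma cintegrableB h k : cintegrable h -> cintegrable k ->
  cintegrable (fun l => h l - k l).
Proof. by move=> ih ik; apply: cintegrableD => //; exact: cintegrableN. Qed.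

Lemma cintegrable_conj h : cintegrable h -> cintegrable (fun l => conjc (h l)).
Proof.
move=> [h1 h2]; split.
  by under eq_fun do rewrite Re_conjc.
by under eq_fun do rewrite Im_conjc; exact: rintegrableN.
Qed.

Lemma cintegrable_sum (I : Type) (r : seq I) (F : I -> R -> R[i]) :
  (forall i, cintegrable (F i)) -> cintegrable (fun l => \sum_(i <- r) F i l).
Proof.
move=> iF; elim: r => [|i r IH].
  by under eq_fun do rewrite big_nil; exact: (cintegrable_real (rintegrable_cst 0)).
by under eq_fun do rewrite big_cons; exact: cintegrableD.
Qed.

Lemma cintegralE h : cintegral h =
  rint (fun l => complex.Re (h l)) +i* rint (fun l => complex.Im (h l)).
Proof. by []. Qed.

Lemma cintegralD h k : cintegrable h -> cintegrable k ->
  cintegral (fun l => h l + k l) = cintegral h + cintegral k.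
Proof.
move=> [h1 h2] [k1 k2]; rewrite !cintegralE; apply: complexP; rewrite /= -rintD//.
  by apply: rint_eq => l _; rewrite ReD.
by apply: rint_eq => l _; rewrite ImD.
Qed.

Lemma cintegralZ z h : cintegrable h ->
  cintegral (fun l => z * h l) = z * cintegral h.
Proof.
move=> [h1 h2]; rewrite !cintegralE.
apply: complexP; rewrite ?Re_mulc ?Im_mulc /= -!rintZ//.
  rewrite -rintB; [|exact: rintegrableZ..].
  by apply: rint_eq => l _; rewrite Re_mulc.
rewrite -rintD; [|exact: rintegrableZ..].
by apply: rint_eq => l _; rewrite Im_mulc.
Qed.

Lemma cintegralN h : cintegrable h -> cintegral (fun l => - h l) = - cintegral h.
Proof.
by move=> ih; under eq_fun do rewrite -mulN1r; rewrite cintegralZ// mulN1r.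
Qed.

Lemma cintegralB h k : cintegrable h -> cintegrable k ->
  cintegral (fun l => h l - k l) = cintegral h - cintegral k.
Proof.
by move=> ih ik; rewrite cintegralD//; [rewrite cintegralN|exact: cintegrableN].
Qed.

Lemma cintegral_sum (I : Type) (r : seq I) (F : I -> R -> R[i]) :
  (forall i, cintegrable (F i)) ->
  cintegral (fun l => \sum_(i <- r) F i l) = \sum_(i <- r) cintegral (F i).
Proof.
move=> iF; elim: r => [|i r IH].
  rewrite big_nil; under eq_fun do rewrite big_nil.
  by rewrite cintegralE /=; apply: complexP; rewrite /= (rint_cst 0) mul0r.
under eq_fun do rewrite big_cons.
by rewrite big_cons cintegralD ?IH//; exact: cintegrable_sum.
Qed.

Lemma cintegral_conj h : cintegrable h ->
  cintegral (fun l => conjc (h l)) = conjc (cintegral h).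
Proof.
move=> [h1 h2]; rewrite !cintegralE; apply: complexP => /=.
  by apply: rint_eq => l _; rewrite Re_conjc.
by rewrite -rintN//; apply: rint_eq => l _; rewrite Im_conjc.
Qed.

Lemma cintegral_real u : cintegral (fun l => (u l)%:C) = (rint u)%:C.
Proof. by rewrite cintegralE /=; apply: complexP => //=; rewrite (rint_cst 0) mul0r. Qed.

Lemma cintegral_eq h k : (forall l, h l = k l) -> cintegral h = cintegral k.
Proof. by move=> hk; congr cintegral; apply/funext. Qed.

(** The factor 2 comes from bounding real and imaginary parts separately; a crude constant suffices,
    since the bound only serves to prove convergence. *)
Lemma cabs_cintegral h : cintegrable h ->
  cabs (cintegral h) <= 2 * rint (fun l => cabs (h l)).
Proof.
move=> ih; have [h1 h2] := ih; have ia := cintegrable_cabs ih.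
apply: le_trans (cabs_le_ReIm _) _; rewrite cintegralE /=.
have hR : rint (fun l => `|complex.Re (h l)|) <= rint (fun l => cabs (h l)).
  by apply: rint_le => //; [exact: rintegrable_abs|move=> l _; exact: abs_Re_le].
have hI : rint (fun l => `|complex.Im (h l)|) <= rint (fun l => cabs (h l)).
  by apply: rint_le => //; [exact: rintegrable_abs|move=> l _; exact: abs_Im_le].
by have := rint_abs h1; have := rint_abs h2; lra.
Qed.

Lemma cintegral_expi (j k : nat) :
  cintegral (fun l : R => expi ((j%:R - k%:R) * l)) =
  if j == k then (2 * pi)%:C else 0.
Proof.
rewrite cintegralE /= rint_cos rint_sin; by case: eqP.
Qed.

End ComplexCircleIntegral.

(** * Convergence of complex sequences, series and exponential sums *)

Section ComplexSequences.
Context {R : realType}.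
Implicit Types (s t : nat -> R[i]) (z w : R[i]) (c x : nat -> R[i]).

(** Stated with the modulus so that norm estimates apply directly; [ccvg_ReIm] translates it to the
    componentwise convergence by which [csum] is defined. *)
Definition ccvg s z : Prop :=
  forall e : R, 0 < e -> \forall n \near \oo, cabs (s n - z) <= e.

Lemma ccvg_ReIm s z :
  ((fun n => complex.Re (s n)) @ \oo --> complex.Re z /\
   (fun n => complex.Im (s n)) @ \oo --> complex.Im z) <-> ccvg s z.
Proof.
split=> [[hR hI] e e0|h].
  have e2 : 0 < e / 2 by lra.
  near=> n; apply: le_trans (cabs_le_ReIm _) _.
  rewrite ReD ReN ImD ImN [leRHS]splitr lerD//.
    by rewrite distrC; near: n; move/cvgrPdist_le : hR; exact.
  by rewrite distrC; near: n; move/cvgrPdist_le : hI; exact.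
split; apply/cvgrPdist_le => e /h; apply: filterS => n; apply: le_trans.
  by rewrite -ReN -ReD -normrN -ReN opprB; exact: abs_Re_le.
by rewrite -ImN -ImD -normrN -ImN opprB; exact: abs_Im_le.
Unshelve. all: by end_near. Qed.

Lemma ccvg_unique s z w : ccvg s z -> ccvg s w -> z = w.
Proof.
by move=> /ccvg_ReIm[h1 h2] /ccvg_ReIm[k1 k2]; apply: complexP;
  [apply: cvg_unique h1 k1|apply: cvg_unique h2 k2]; exact: norm_hausdorff.
Qed.

Lemma ccvg_cst z : ccvg (fun=> z) z.
Proof. by move=> e e0; apply: nearW => n; rewrite subrr cabs0 ltW. Qed.

Lemma ccvgZ s z w : ccvg s z -> ccvg (fun n => w * s n) (w * z).
Proof.
move=> hs e e0; have k0 : 0 < cabs w + 1 by rewrite ltr_wpDl// cabs_ge0.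
have /hs : 0 < e / (cabs w + 1) by rewrite divr_gt0.
apply: filterS => n h; rewrite -mulrBr cabsM.
rewrite ler_pdivlMr// mulrC in h; apply: le_trans h.
by rewrite ler_wpM2r ?cabs_ge0// lerDl.
Qed.

Lemma ccvg_conj s z : ccvg s z -> ccvg (fun n => conjc (s n)) (conjc z).
Proof.
move=> hs e /hs; apply: filterS => n.
by rewrite -[conjc (s n) - _](rmorphB (@conjc R)) cabs_conj.
Qed.

Lemma ccvg_le s z w (M : R) : ccvg s z ->
  (\forall n \near \oo, cabs (s n - w) <= M) -> cabs (z - w) <= M.
Proof.
move=> hs hM; apply/ler_addgt0Pl => e e0.
near \oo => n.
rewrite (_ : z - w = - (s n - z) + (s n - w)); last by ring.
apply: le_trans (cabsD _ _) _; rewrite cabsN lerD//; near: n => //.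
exact: hs.
Unshelve. all: by end_near. Qed.

Lemma series_ReIm (u : nat -> R[i]) :
  (series (fun k => complex.Re (u k)) = fun n => complex.Re (\sum_(k < n) u k)) /\
  (series (fun k => complex.Im (u k)) = fun n => complex.Im (\sum_(k < n) u k)).
Proof.
split; apply/funext => n; rewrite /series /= big_mkord.
  by rewrite Re_sum.
by rewrite Im_sum.
Qed.

Lemma ccvg_csum (u : nat -> R[i]) z : ccvg (fun n => \sum_(k < n) u k) z -> csum u = z.
Proof.
move=> /ccvg_ReIm[h1 h2]; rewrite /csum.
have [-> ->] := series_ReIm u.
by apply: complexP => /=; apply/cvg_lim.
Qed.

Lemma csummable_ccvg (u : nat -> R[i]) : csummable u ->
  ccvg (fun n => \sum_(k < n) u k) (csum u).
Proof.
by rewrite /csummable /csum; have [-> ->] := series_ReIm u => h; exact/ccvg_ReIm.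
Qed.

Lemma csummable_abs (u : nat -> R[i]) : cvgn (series (fun k => cabs (u k))) ->
  csummable u.
Proof.
move=> h; split; apply: normed_cvg; apply: series_le_cvg h => // k;
  rewrite /= ?cabs_ge0 ?normr_ge0//.
  exact: abs_Re_le.
exact: abs_Im_le.
Qed.

Definition psum c n (l : R) : R[i] := \sum_(j < n) c j * expi (j%:R * l).

Lemma cintegrable_expi (r : R) : cintegrable (fun l : R => expi (r * l)).
Proof.
apply: (@cintegrable_bounded_ae _ _ 1); first exact: cmeasurable_expi.
by apply: ae_circleW => l _; rewrite cabs_expi.
Qed.

Lemma cintegrable_psum c n : cintegrable (psum c n).
Proof. by apply: cintegrable_sum => j; apply: cintegrableZ; exact: cintegrable_expi. Qed.

Lemma cmeasurable_psum c n : cmeasurable (psum c n).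
Proof. exact/cintegrable_measurable/cintegrable_psum. Qed.

Lemma psum_bounded c n l : cabs (psum c n l) <= \sum_(j < n) cabs (c j).
Proof.
apply: le_trans (cabs_sum _ _) _; apply: ler_sum => j _.
by rewrite cabsM cabs_expi mulr1.
Qed.

Lemma ccvg_cintegral (h : nat -> R -> R[i]) (k : R -> R[i]) :
  (forall n, cintegrable (h n)) -> cintegrable k ->
  (forall e : R, 0 < e -> \forall n \near \oo, rint (fun l => cabs (h n l - k l)) <= e) ->
  ccvg (fun n => cintegral (h n)) (cintegral k).
Proof.
move=> ih ik hk e e0; have /hk : 0 < e / 2 by lra.
apply: filterS => n hn; rewrite -cintegralB//.
by apply: le_trans (cabs_cintegral _) _; [exact: cintegrableB|lra].
Qed.

End ComplexSequences.

(** * The absolutely convergent series A *)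

Section AbsolutelySummable.
Context {R : realType}.
Variable a : nat -> R[i].
Hypothesis ha : cvgn (series (fun j => cabs (a j))).

(** At [n = 0] this is the whole l1 norm of [a], used from here on as the uniform bound of
    [Afun a]. *)
Definition abs_tail n : R :=
  limn (series (fun j => cabs (a j))) - series (fun j => cabs (a j)) n.

Lemma ccvg_Afun l : ccvg (fun n => psum a n l) (Afun a l).
Proof.
apply: csummable_ccvg; apply: csummable_abs.
by under eq_fun do rewrite cabsM cabs_expi mulr1.
Qed.

Lemma Afun_tail n l : cabs (Afun a l - psum a n l) <= abs_tail n.
Proof.
apply: (ccvg_le (ccvg_Afun l)); exists n => // m /= nm.
have hle : series (fun j => cabs (a j)) m <= limn (series (fun j => cabs (a j))).
  apply: nondecreasing_cvgn_le => //.
  by apply: nondecreasing_series => k _ _; exact: cabs_ge0.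
apply: le_trans (lerB hle (lexx _)).
rewrite /psum /series /= -!(big_mkord xpredT (fun j => a j * expi (j%:R * l))).
rewrite (big_cat_nat (leq0n n) nm) /= addrAC subrr add0r.
rewrite [X in X - _](big_cat_nat (leq0n n) nm) /= addrAC subrr add0r.
apply: le_trans (cabs_sum _ _) _; apply: ler_sum => j _.
by rewrite cabsM cabs_expi mulr1.
Qed.

Lemma abs_tail_cvg (e : R) : 0 < e -> \forall n \near \oo, abs_tail n <= e.
Proof.
move=> e0; move/cvgrPdist_le : ha => /(_ _ e0); apply: filterS => n.
by apply: le_trans; exact: ler_norm.
Qed.

Lemma Afun_bounded l : cabs (Afun a l) <= abs_tail 0.
Proof. by have := Afun_tail 0 l; rewrite /psum big_ord0 subr0. Qed.

Lemma cmeasurable_Afun : cmeasurable (Afun a).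
Proof.
have mp n := cmeasurable_psum a n.
split.
  apply: (@measurable_fun_cvg _ _ _ _ (fun n l => complex.Re (psum a n l))).
    by move=> n; have [] := mp n.
  by move=> l _; have /ccvg_ReIm[] := ccvg_Afun l.
apply: (@measurable_fun_cvg _ _ _ _ (fun n l => complex.Im (psum a n l))).
  by move=> n; have [] := mp n.
by move=> l _; have /ccvg_ReIm[] := ccvg_Afun l.
Qed.

Lemma cintegrable_Afun u : cintegrable u -> cintegrable (fun l => Afun a l * u l).
Proof.
apply: (@cintegrableM_bounded _ _ _ (abs_tail 0)); first exact: cmeasurable_Afun.
by apply: ae_circleW => l _; exact: Afun_bounded.
Qed.

Lemma cintegrable_psumM (c : nat -> R[i]) n (u : R -> R[i]) : cintegrable u ->
  cintegrable (fun l => psum c n l * u l).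
Proof.
apply: (@cintegrableM_bounded _ _ _ (\sum_(j < n) cabs (c j))).
  exact: cmeasurable_psum.
by apply: ae_circleW => l _; exact: psum_bounded.
Qed.

(** The series of A converges uniformly, so an integrable factor [u] is enough. This lets Toeplitz
    matrices with merely integrable symbols act on [a]. *)
Lemma ccvg_cintegral_Afun u : cintegrable u ->
  ccvg (fun n => cintegral (fun l => psum a n l * u l))
       (cintegral (fun l => Afun a l * u l)).
Proof.
move=> iu; apply: ccvg_cintegral => [n||e e0].
- exact: cintegrable_psumM.
- exact: cintegrable_Afun.
have iau := cintegrable_cabs iu.
set I := rint (fun l => cabs (u l)).
have I0 : 0 <= I by apply: rint_ge0 => l _; exact: cabs_ge0.
have I1 : 0 < I + 1 by rewrite ltr_wpDl.
have : \forall n \near \oo, abs_tail n <= e / (I + 1).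
  by apply: abs_tail_cvg; rewrite divr_gt0.
apply: filterS => n hn.
apply: (@le_trans _ _ (rint (fun l => abs_tail n * cabs (u l)))).
  apply: rint_le.
  - apply: cintegrable_cabs; apply: cintegrableB; first exact: cintegrable_psumM.
    exact: cintegrable_Afun.
  - exact: rintegrableZ.
  - move=> l _; rewrite -mulrBl cabsM -cabsN opprB ler_wpM2r ?cabs_ge0//.
    exact: Afun_tail.
rewrite rintZ//; apply: le_trans (ler_wpM2r I0 hn) _.
by rewrite -mulrA ger_pMr// mulrC ler_pdivrMr// mul1r lerDl.
Qed.

End AbsolutelySummable.

(** * Series converging in L2 *)

Section L2Sums.
Context {R : realType}.
Implicit Types (c : nat -> R[i]) (h C u : R -> R[i]).

Lemma sqnormL2_lty h (w : R -> R) : cmeasurable h -> measurable_fun circle w ->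
  (forall l, circle l -> 0 <= w l) ->
  (sqnormL2 w h < +oo)%E -> rintegrable (fun l => cabs (h l) ^+ 2 * w l).
Proof.
move=> mh mw w0; apply: rintegrable_lty.
  by apply: measurable_funM => //; exact: measurable_cabs_sqr.
by move=> l cl; rewrite mulr_ge0 ?sqr_ge0// w0.
Qed.

(** Equivalent to d y <= d^2 + y^2. With its free parameter [d] it replaces the Cauchy-Schwarz
    inequality where smallness of a square has to pass to the modulus. *)
Lemma cabs_le_sqr (z : R[i]) (d : R) : 0 < d -> cabs z <= d + d^-1 * cabs z ^+ 2.
Proof.
move=> d0; have z0 := cabs_ge0 z; set y := cabs z in z0 *.
rewrite -(ler_pM2l d0) mulrDr mulrA divff ?gt_eqF// mul1r.
nra.
Qed.

(** The square norms tend to 0 in the extended reals, so finiteness, hence integrability, is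
    guaranteed only from some index on. *)
Lemma is_L2_sum_near c C : is_L2_sum c C -> forall e, 0 < e ->
  \forall n \near \oo, rintegrable (fun l => cabs (C l - psum c n l) ^+ 2) /\
    rint (fun l => cabs (C l - psum c n l) ^+ 2) <= e.
Proof.
move=> [mC hC] e e0.
have mD n : cmeasurable (fun l => C l - psum c n l).
  by apply: cmeasurableB => //; exact: cmeasurable_psum.
have /fine_cvgP[hfin /cvgrPdist_le /(_ _ e0)] := hC.
move: hfin; apply: filterS2 => n hn.
have hi : rintegrable (fun l => cabs (C l - psum c n l) ^+ 2).
  rewrite (_ : (fun l => _) = fun l => cabs (C l - psum c n l) ^+ 2 * 1); last first.
    by apply/funext => l; rewrite mulr1.
  apply: (@sqnormL2_lty _ (fun=> 1)) => //.
  by move: hn; rewrite fin_numE -ltey => /andP[].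
rewrite /= sub0r normrN => h; split => //.
apply: le_trans h; apply: le_trans (ler_norm _).
rewrite le_eqVlt; apply/orP; left; apply/eqP; rewrite /sqnormL2 /rint /Rintegral.
by congr fine; apply: eq_integral => l _; rewrite mulr1.
Qed.

Lemma cintegrable_sqr h : cmeasurable h -> rintegrable (fun l => cabs (h l) ^+ 2) ->
  cintegrable h.
Proof.
move=> mh ih; apply: (@cintegrable_le _ _ (fun l => 1 + 1^-1 * cabs (h l) ^+ 2)) => //.
  by apply: rintegrableD; [exact: rintegrable_cst|exact: rintegrableZ].
by move=> l _; exact: cabs_le_sqr.
Qed.

Lemma cintegrable_L2_sum c C : is_L2_sum c C -> cintegrable C.
Proof.
move=> hC; have [N _ hN] := is_L2_sum_near hC (@ltr01 R).
have [ih _] := hN N (leqnn N); have [mC _] := hC.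
rewrite (_ : C = fun l => (C l - psum c N l) + psum c N l); last first.
  by apply/funext => l; rewrite subrK.
apply: cintegrableD; last exact: cintegrable_psum.
apply: cintegrable_sqr => //; apply: cmeasurableB => //; exact: cmeasurable_psum.
Qed.

Lemma is_L2_sum_L1 c C : is_L2_sum c C -> forall e, 0 < e ->
  \forall n \near \oo, rint (fun l => cabs (C l - psum c n l)) <= e.
Proof.
move=> hC e e0; have iC := cintegrable_L2_sum hC; have tp := @twopi_gt0 R.
(* The constant [d] integrates to e / 2 over the circle, and a squared distance of at most d (e / 2)
   contributes another e / 2 after division by [d]. *)
pose d := e / 2 / (2 * pi); have d0 : 0 < d by rewrite !divr_gt0.
have := is_L2_sum_near hC (mulr_gt0 d0 (divr_gt0 e0 (@ltr0Sn R 1))).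
apply: filterS => n [ih hn].
have iD : cintegrable (fun l => C l - psum c n l).
  by apply: cintegrableB => //; exact: cintegrable_psum.
apply: (@le_trans _ _ (rint (fun l => d + d^-1 * cabs (C l - psum c n l) ^+ 2))).
  apply: rint_le; first exact: cintegrable_cabs.
    by apply: rintegrableD; [exact: rintegrable_cst|exact: rintegrableZ].
  by move=> l _; exact: cabs_le_sqr.
rewrite rintD; [|exact: rintegrable_cst|exact: rintegrableZ].
rewrite rint_cst rintZ// divfK ?gt_eqF// [leRHS]splitr lerD2l.
by rewrite mulrC ler_pdivrMr// mulrC.
Qed.

(** [C] is only an L2 limit, so the factor is taken essentially bounded, in contrast with the case
    of A above. Applied to 1 / (f + g0) times an exponential, this is where the bound on the symbol
    is spent. *)
Lemma ccvg_cintegral_L2 c C u (M : R) : is_L2_sum c C -> cmeasurable u ->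
  ae_circle (fun l => cabs (u l) <= M) ->
  ccvg (fun n => cintegral (fun l => u l * psum c n l))
       (cintegral (fun l => u l * C l)).
Proof.
move=> hC mu uM; have iC := cintegrable_L2_sum hC.
have iM k : cintegrable k -> cintegrable (fun l => u l * k l).
  exact: cintegrableM_bounded mu uM.
have ip n := cintegrable_psum c n.
apply: ccvg_cintegral => [n||e e0]; [exact: iM|exact: iM|].
pose K := `|M| + 1; have K0 : 0 < K by rewrite ltr_wpDl.
have := is_L2_sum_L1 hC (divr_gt0 e0 K0); apply: filterS => n hn.
have iD : cintegrable (fun l => C l - psum c n l) by exact: cintegrableB.
apply: (@le_trans _ _ (rint (fun l => K * cabs (C l - psum c n l)))).
  apply: rint_le_ae.
  - by apply: cintegrable_cabs; apply: cintegrableB; exact: iM.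
  - by apply: rintegrableZ; exact: cintegrable_cabs.
  - move: uM; apply: ae_circle_imp => l _ ul.
    rewrite -mulrBr cabsM -[cabs (psum _ _ _ - _)]cabsN opprB ler_wpM2r ?cabs_ge0//.
    by rewrite (le_trans ul)// (le_trans (ler_norm _))// lerDl.
rewrite rintZ; last exact: cintegrable_cabs.
by rewrite mulrC -ler_pdivlMr.
Qed.

End L2Sums.

(** * Toeplitz matrices and Fourier coefficients *)

Section Toeplitz.
Context {R : realType}.
Implicit Types (phi : R -> R) (u C : R -> R[i]) (x c b : nat -> R[i]).

Local Notation tp := ((2 * pi)^-1%:C : R[i]).

Definition fcoef u (j : nat) : R[i] :=
  tp * cintegral (fun l => expi (- j%:R * l) * u l).

(** The outer conjugation puts [psum b n] itself under the integral, where the convergence results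
    for partial sums apply. *)
Lemma sum_fcoef_conj u b n : cintegrable u ->
  \sum_(j < n) fcoef u j * conjc (b j) =
  tp * conjc (cintegral (fun l => psum b n l * conjc (u l))).
Proof.
move=> iu; have icu := cintegrable_conj iu.
under [X in conjc (cintegral X)]eq_fun do rewrite mulr_suml.
rewrite cintegral_sum; last first.
  by move=> j; under eq_fun do rewrite -mulrA;
    apply: cintegrableZ; exact: cintegrable_expiM.
rewrite conjc_sum mulr_sumr; apply: eq_bigr => j _.
under [X in conjc (cintegral X)]eq_fun do rewrite -mulrA.
rewrite cintegralZ; last exact: cintegrable_expiM.
rewrite conjcM -cintegral_conj; last exact: cintegrable_expiM.
rewrite /fcoef -mulrA; congr (_ * _); rewrite mulrC; congr (_ * _).
by apply: cintegral_eq => l; rewrite conjcM conjcK conjc_expi mulNr.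
Qed.

Lemma toeplitz_sum phi x j n : rintegrable phi ->
  \sum_(k < n) toeplitz phi j k * x k =
  tp * cintegral (fun l => psum x n l * (expi (- j%:R * l) * (phi l)%:C)).
Proof.
move=> iphi; have ic := cintegrable_expiM (- j%:R) (cintegrable_real iphi).
under [X in cintegral X]eq_fun do rewrite mulr_suml.
rewrite cintegral_sum; last first.
  by move=> k; under eq_fun do rewrite -mulrA;
    apply: cintegrableZ; exact: cintegrable_expiM.
rewrite mulr_sumr; apply: eq_bigr => k _.
rewrite /toeplitz -mulrA; congr (_ * _); rewrite mulrC -cintegralZ; last first.
  by apply: cintegrable_expiM; exact: cintegrable_real.
apply: cintegral_eq => l; rewrite -!mulrA; congr (_ * _); rewrite mulrA -expiD.
by congr (expi _ * _); ring.
Qed.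

Lemma mxop_toeplitz_l1 phi a j : cvgn (series (fun j => cabs (a j))) ->
  rintegrable phi ->
  mxop (toeplitz phi) a j = fcoef (fun l => Afun a l * (phi l)%:C) j.
Proof.
move=> ha iphi; apply: ccvg_csum.
under eq_fun do rewrite toeplitz_sum//.
have ic := cintegrable_expiM (- j%:R) (cintegrable_real iphi).
have -> : fcoef (fun l => Afun a l * (phi l)%:C) j =
    tp * cintegral (fun l => Afun a l * (expi (- j%:R * l) * (phi l)%:C)).
  by congr (_ * _); apply: cintegral_eq => l; ring.
exact/ccvgZ/ccvg_cintegral_Afun.
Qed.

Lemma mxop_toeplitz_L2 phi c C (M : R) j : rintegrable phi ->
  ae_circle (fun l => `|phi l| <= M) -> is_L2_sum c C ->
  mxop (toeplitz phi) c j = fcoef (fun l => (phi l)%:C * C l) j.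
Proof.
move=> iphi hM hC; apply: ccvg_csum.
have E n : cintegral (fun l => psum c n l * (expi (- j%:R * l) * (phi l)%:C)) =
    cintegral (fun l => expi (- j%:R * l) * (phi l)%:C * psum c n l).
  by apply: cintegral_eq => l; rewrite mulrC.
under eq_fun do rewrite toeplitz_sum// E.
rewrite /fcoef; under [X in cintegral X]eq_fun do rewrite mulrA.
apply: ccvgZ; apply: (ccvg_cintegral_L2 (M := M)) => //.
  apply: cmeasurableM; first exact: cmeasurable_expi.
  by apply: cmeasurable_real; exact: rintegrable_measurable.
by move: hM; apply: ae_circle_imp => l _; rewrite cabsM cabs_expi mul1r cabs_real.
Qed.

Lemma inner_fcoef_Afun u a : cvgn (series (fun j => cabs (a j))) -> cintegrable u ->
  inner (fcoef u) a = tp * cintegral (fun l => u l * conjc (Afun a l)).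
Proof.
move=> ha iu; apply: ccvg_csum; under eq_fun do rewrite sum_fcoef_conj//.
apply: ccvgZ.
have -> : cintegral (fun l => u l * conjc (Afun a l)) =
    conjc (cintegral (fun l => Afun a l * conjc (u l))).
  rewrite -cintegral_conj; last by apply: cintegrable_Afun => //; exact: cintegrable_conj.
  by apply: cintegral_eq => l; rewrite conjcM conjcK mulrC.
by apply/ccvg_conj/ccvg_cintegral_Afun => //; exact: cintegrable_conj.
Qed.

(** Kept as a convergence statement, beyond the value of [inner], because the summability it
    contains is needed later to pull a scalar out of [inner]. *)
Lemma ccvg_inner_fcoef_L2 u c C (M : R) : cmeasurable u ->
  ae_circle (fun l => cabs (u l) <= M) -> is_L2_sum c C ->
  ccvg (fun n => \sum_(j < n) fcoef u j * conjc (c j))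
       (tp * cintegral (fun l => u l * conjc (C l))).
Proof.
move=> mu uM hC; have iu := cintegrable_bounded_ae mu uM.
under eq_fun do rewrite sum_fcoef_conj//.
have mcu := cmeasurable_conj mu.
have cuM : ae_circle (fun l => cabs (conjc (u l)) <= M).
  by move: uM; apply: ae_circle_imp => l _; rewrite cabs_conj.
apply: ccvgZ.
have -> : cintegral (fun l => u l * conjc (C l)) =
    conjc (cintegral (fun l => conjc (u l) * C l)).
  rewrite -cintegral_conj; last first.
    by apply: cintegrableM_bounded cuM _ => //; exact: cintegrable_L2_sum hC.
  by apply: cintegral_eq => l; rewrite conjcM conjcK.
have E n : cintegral (fun l => psum c n l * conjc (u l)) =
    cintegral (fun l => conjc (u l) * psum c n l).
  by apply: cintegral_eq => l; rewrite mulrC.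
apply: ccvg_conj; under eq_fun do rewrite E.
exact: ccvg_cintegral_L2 hC mcu cuM.
Qed.

Lemma inner_fcoef_L2 u c C (M : R) : cmeasurable u ->
  ae_circle (fun l => cabs (u l) <= M) -> is_L2_sum c C ->
  inner (fcoef u) c = tp * cintegral (fun l => u l * conjc (C l)).
Proof.
by move=> mu uM hC; apply: ccvg_csum; exact: ccvg_inner_fcoef_L2 uM hC.
Qed.

Lemma fcoef_psum b n (j : 'I_n) : fcoef (psum b n) j = b j.
Proof.
rewrite /fcoef; under [X in cintegral X]eq_fun do rewrite mulr_sumr.
rewrite (@cintegral_eq _ _ (fun l => \sum_(k < n) b k * expi ((k%:R - j%:R) * l))).
  rewrite cintegral_sum; last by move=> k; apply: cintegrableZ; exact: cintegrable_expi.
  rewrite (bigD1 j)//= big1 ?addr0; last first.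
    move=> k kj; rewrite cintegralZ; last exact: cintegrable_expi.
    by rewrite cintegral_expi ifF ?mulr0//; apply/negbTE.
  rewrite cintegralZ; last exact: cintegrable_expi.
  rewrite cintegral_expi eqxx mulrCA -real_complexM mulVf ?mulr1//.
  by rewrite gt_eqF// twopi_gt0.
move=> l; apply: eq_bigr => k _; rewrite mulrCA -expiD; congr (_ * expi _); ring.
Qed.

Lemma parseval_psum b n :
  rint (fun l => cabs (psum b n l) ^+ 2) = 2 * pi * \sum_(j < n) cabs (b j) ^+ 2.
Proof.
have := sum_fcoef_conj b n (cintegrable_psum b n).
rewrite (eq_bigr (fun j : 'I_n => (cabs (b j) ^+ 2)%:C)); last first.
  by move=> j _; rewrite fcoef_psum mulc_conj.
rewrite (@cintegral_eq _ _ (fun l => (cabs (psum b n l) ^+ 2)%:C)); last first.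
  by move=> l; rewrite mulc_conj.
rewrite cintegral_real => /(congr1 (@complex.Re R)); rewrite Re_sum.
rewrite Re_mulc /= mul0r subr0.
by move=> ->; rewrite mulVKf// gt_eqF// twopi_gt0.
Qed.

Lemma bessel_sum u n : cintegrable u -> rintegrable (fun l => cabs (u l) ^+ 2) ->
  2 * pi * \sum_(j < n) cabs (fcoef u j) ^+ 2 <= rint (fun l => cabs (u l) ^+ 2).
Proof.
move=> iu iu2; set b := fcoef u; set S := \sum_(_ < _) _.
have h1 := parseval_psum b n; rewrite -/S in h1.
have h2 : complex.Re (cintegral (fun l => psum b n l * conjc (u l))) = 2 * pi * S.
  have := sum_fcoef_conj b n iu.
  rewrite (eq_bigr (fun j : 'I_n => (cabs (b j) ^+ 2)%:C)); last first.
    by move=> j _; rewrite mulc_conj.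
  move=> /(congr1 (@complex.Re R)); rewrite Re_sum Re_mulc /= mul0r subr0 /S => ->.
  by rewrite ?Re_conjc mulVKf// gt_eqF// twopi_gt0.
have ip := cintegrable_psumM b n (cintegrable_conj iu).
have i1 : rintegrable (fun l => complex.Re (psum b n l * conjc (u l))) by case: ip.
have i2 : rintegrable (fun l => cabs (psum b n l) ^+ 2).
  have [+ _] := cintegrable_psumM b n (cintegrable_conj (cintegrable_psum b n)).
  by congr rintegrable; apply/funext => l; rewrite mulc_conj.
(* The integrand is |u - psum b n|^2 expanded. As [b] consists of the coefficients of [u], the
   subtracted term integrates to twice 2 pi S and the last one to 2 pi S. *)
have : 0 <= rint (fun l => cabs (u l) ^+ 2 - 2 * complex.Re (psum b n l * conjc (u l))
                            + cabs (psum b n l) ^+ 2).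
  apply: rint_ge0 => l _.
  rewrite (_ : _ + _ = cabs (u l - psum b n l) ^+ 2) ?sqr_ge0//.
  by rewrite !cabs_sqr Re_mulc ReD ImD ReN ImN Re_conjc Im_conjc; ring.
rewrite rintD//; last by apply: rintegrableB => //; exact: rintegrableZ.
rewrite rintB//; last exact: rintegrableZ.
by rewrite rintZ// h1 -[rint (fun l => complex.Re _)]/(complex.Re (cintegral _)) h2; lra.
Qed.

Lemma bessel u (M : R) : cmeasurable u -> ae_circle (fun l => cabs (u l) <= M) ->
  ell2 (fcoef u).
Proof.
move=> mu uM; have iu := cintegrable_bounded_ae mu uM.
have iu2 : rintegrable (fun l => cabs (u l) ^+ 2).
  apply: (@rintegrable_bounded_ae _ _ (M ^+ 2)); first exact: measurable_cabs_sqr.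
  move: uM; apply: ae_circle_imp => l _ h.
  by rewrite ger0_norm ?sqr_ge0// ler_sqr ?nnegrE ?cabs_ge0// (le_trans (cabs_ge0 _) h).
apply: nondecreasing_is_cvgn.
  by apply: nondecreasing_series => k _ _; exact: sqr_ge0.
exists ((2 * pi)^-1 * rint (fun l => cabs (u l) ^+ 2)) => _ [n _ <-].
rewrite /series /= big_mkord -ler_pdivrMl ?invr_gt0 ?twopi_gt0// invrK.
exact: bessel_sum.
Qed.

End Toeplitz.

(** * A bounded Toeplitz operator has an essentially bounded symbol *)

Section SymbolBound.
Context {R : realType}.
Implicit Types (phi : R -> R) (x : nat -> R[i]).

Lemma sum_truncate (V : nmodType) (F : nat -> V) N m : (N <= m)%N ->
  (forall k, (N <= k)%N -> F k = 0) -> \sum_(k < m) F k = \sum_(k < N) F k.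
Proof.
move=> Nm F0; rewrite -(big_mkord xpredT F) (big_cat_nat (leq0n N) Nm) /=.
rewrite big_mkord [X in _ + X]big1_seq ?addr0// => k /=.
by rewrite mem_index_iota => /andP[+ _]; exact: F0.
Qed.

(* The quadratic form of the Toeplitz matrix at the character of frequency t is
   a Fejer mean of its symbol at t. *)
Lemma fejer_quadratic phi n t : rintegrable phi ->
  complex.Re (\sum_(j < n.+1) (\sum_(k < n.+1) toeplitz phi j k * expi (- k%:R * t))
      * expi (j%:R * t)) = n.+1%:R * fejer n.+1 phi t.
Proof.
move=> iphi; rewrite fejer_expand// mulr_sumr Re_sum; apply: eq_bigr => j _.
rewrite mulr_suml mulr_sumr Re_sum; apply: eq_bigr => k _.
have -> : toeplitz phi j k * expi (- k%:R * t) * expi (j%:R * t) =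
    toeplitz phi j k * expi ((j%:R - k%:R) * t).
  by rewrite -mulrA -expiD; congr (_ * expi _); ring.
set m : R := j%:R - k%:R.
have E1 : rint (fun l => complex.Re (expi (- m * l) * (phi l)%:C)) =
    rint (fun l => cos (m * l) * phi l).
  by apply: rint_eq => l _; rewrite Re_mulc /= mulr0 subr0 mulNr cosN.
have E2 : rint (fun l => complex.Im (expi (- m * l) * (phi l)%:C)) =
    - rint (fun l => sin (m * l) * phi l).
  rewrite -rintN; last exact: rintegrable_sinZ.
  by apply: rint_eq => l _; rewrite Im_mulc /= mulr0 add0r mulNr sinN mulNr.
rewrite /toeplitz -/m cintegralE E1 E2 !Re_mulc !Im_mulc /= !mul0r subr0 addr0.
rewrite [RHS]mulrCA mulVKf//; ring.
Qed.

(** The test vector is a character cut to [n.+1] entries, whose norm is the square root of [n.+1].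
    Boundedness of the operator then bounds all Fejer means of the symbol by one constant, and L1
    convergence hands this bound to the symbol. *)
Lemma toeplitz_symbol_bounded phi : rintegrable phi -> mx_bounded (toeplitz phi) ->
  exists K : R, ae_circle (fun l => phi l <= K).
Proof.
move=> iphi [_ [K hK]].
(* Each entry of the image [y] is estimated by |y| <= 1 + |y|^2, and [n.+1] of these sum to at most
   (1 + K^2) times [n.+1]; hence 1 + K^2 instead of the K of Cauchy-Schwarz. *)
suff hb n t : fejer n.+1 phi t <= 1 + K ^+ 2.
  exists (1 + K ^+ 2); set L := 1 + K ^+ 2.
  have iL := @rintegrable_cst R L.
  have mm : measurable_fun circle (fun l => Num.max 0 (phi l - L)).
    by apply: measurable_maxr => //; apply: rintegrable_measurable; exact: rintegrableB.
  have im : rintegrable (fun l => Num.max 0 (phi l - L)).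
    apply: (@rintegrable_le _ _ (fun l => `|phi l - L|)) => //.
      by apply: rintegrable_abs; exact: rintegrableB.
    by move=> l _; rewrite ger0_norm ?le_max ?lexx// ge_max normr_ge0 ler_norm.
  have m0 l : 0 <= Num.max 0 (phi l - L) by rewrite le_max lexx.
  (* As the Fejer mean is at most [L], the positive part of phi - L is at most the distance from
     [phi] to its mean, whose integral is arbitrarily small. *)
  have : rint (fun l => Num.max 0 (phi l - L)) <= 0.
    apply/ler_addgt0Pl => e e0; rewrite addr0.
    have [N _ /(_ N (leqnn N)) hN] := fejer_L1 iphi e0; apply: le_trans hN.
    apply: rint_le => //.
      by apply: rintegrable_abs; apply: rintegrableB => //; exact: rintegrable_fejer.
    move=> l _; rewrite ge_max normr_ge0 /=.
    by rewrite distrC (le_trans _ (ler_norm _))// lerB.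
  move=> /(rint_eq0_ae im (fun l _ => m0 l)); apply: ae_circle_imp => l _ h.
  have : phi l - L <= 0 by rewrite -h le_max lexx orbT.
  by rewrite subr_le0.
set N := n.+1.
pose x k : R[i] := if (k < N)%N then expi (- k%:R * t) else 0.
have xE k : (k < N)%N -> x k = expi (- k%:R * t) by rewrite /x => ->.
have x0 k : (N <= k)%N -> x k = 0 by rewrite /x ltnNge => ->.
have sx m : (N <= m)%N -> series (fun k => cabs (x k) ^+ 2) m = N%:R.
  move=> Nm; rewrite /series /= big_mkord.
  rewrite (sum_truncate (F := fun k => cabs (x k) ^+ 2) Nm); last first.
    by move=> k /x0 ->; rewrite cabs0 expr0n.
  rewrite (eq_bigr (fun=> 1)) ?sumr_const ?card_ord//.
  by move=> k _; rewrite xE// cabs_expi expr1n.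
have lx : series (fun k => cabs (x k) ^+ 2) @ \oo --> (N%:R : R).
  by apply: cvg_near_cst; exists N => // m /= /sx.
have ex : ell2 x by apply/cvg_ex; exists N%:R.
have [ey ny] := hK x ex.
set y := mxop _ x in ey ny.
have yE j : y j = \sum_(k < N) toeplitz phi j k * expi (- k%:R * t).
  apply: ccvg_csum => e e0; exists N => // m /= Nm.
  rewrite (sum_truncate (F := fun k => toeplitz phi j k * x k) Nm); last first.
    by move=> k /x0 ->; rewrite mulr0.
  rewrite (eq_bigr (fun k : 'I_N => toeplitz phi j k * expi (- k%:R * t))); last first.
    by move=> k _; rewrite xE.
  by rewrite subrr cabs0 ltW.
have sy : \sum_(j < N) cabs (y j) ^+ 2 <= K ^+ 2 * N%:R.
  have nd : {homo series (fun k => cabs (y k) ^+ 2) : p q / (p <= q)%N >-> p <= q}.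
    by apply: nondecreasing_series => k _ _; exact: sqr_ge0.
  have := nondecreasing_cvgn_le nd ey N; rewrite {1}/series /= big_mkord.
  move=> h; apply: le_trans h _.
  have l0 : 0 <= limn (series (fun k => cabs (y k) ^+ 2)).
    have := nondecreasing_cvgn_le nd ey 0; rewrite {1}/series /= big_geq//.
  rewrite -[leLHS](sqr_sqrtr l0) -[N%:R](sqr_sqrtr (ler0n R N)) -exprMn.
  have nx : ell2norm x = Num.sqrt N%:R by rewrite /ell2norm (cvg_lim _ lx).
  rewrite nx in ny; rewrite ler_sqr ?nnegrE ?sqrtr_ge0//.
  exact: le_trans (sqrtr_ge0 _) ny.
have N0 : 0 < N%:R :> R by [].
rewrite -(ler_pM2l N0) -fejer_quadratic//.
apply: le_trans (ler_norm _) _; apply: le_trans (abs_Re_le _) _.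
apply: le_trans (cabs_sum _ _) _.
apply: (@le_trans _ _ (\sum_(j < N) (1 + 1^-1 * cabs (y j) ^+ 2))).
  by apply: ler_sum => j _; rewrite -yE cabsM cabs_expi mulr1 cabs_le_sqr.
rewrite big_split /= sumr_const card_ord invr1.
by under eq_bigr do rewrite mul1r; rewrite mulrDr mulr1 lerD2l mulrC.
Qed.

End SymbolBound.

(** * Polynomials in the past and complex Fejer means *)

Section PastPolynomials.
Context {R : realType}.
Implicit Types (h p q : R -> R[i]) (u w : R -> R).

Lemma past_polyD p q : past_poly p -> past_poly q -> past_poly (fun l => p l + q l).
Proof.
move=> [n [c ->]] [m [d ->]].
exists (maxn n m), (fun k => (if (k < n)%N then c k else 0) +
                             (if (k < m)%N then d k else 0)).
have trunc N (x : nat -> R[i]) l : (N <= maxn n m)%N ->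
    \sum_(k < N) x k * expi (- k.+1%:R * l) =
    \sum_(k < maxn n m) (if (k < N)%N then x k else 0) * expi (- k.+1%:R * l).
  move=> hN.
  rewrite (sum_truncate (F := fun k => (if (k < N)%N then x k else 0) *
    expi (- k.+1%:R * l)) hN); last by move=> k; rewrite ltnNge => ->; rewrite mul0r.
  by apply: eq_bigr => k _; rewrite ltn_ord.
apply/funext => l; rewrite trunc ?leq_maxl// [X in _ + X]trunc ?leq_maxr//.
by rewrite -big_split /=; apply: eq_bigr => k _; rewrite mulrDl.
Qed.

Lemma past_poly0 : past_poly (fun=> 0 : R[i]).
Proof. by exists 0%N, (fun=> 0); apply/funext => l; rewrite big_ord0. Qed.

Lemma past_polyZ z p : past_poly p -> past_poly (fun l => z * p l).
Proof.
move=> [n [c ->]]; exists n, (fun k => z * c k); apply/funext => l.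
by rewrite mulr_sumr; apply: eq_bigr => k _; rewrite mulrA.
Qed.

Lemma past_poly_expi (m : nat) : past_poly (fun l : R => expi (- m.+1%:R * l)).
Proof.
exists m.+1, (fun k => (k == m)%:R); apply/funext => l.
rewrite big_ord_recr /= eqxx mul1r big1 ?add0r// => k _.
by rewrite ltn_eqF// mul0r.
Qed.

Lemma past_poly_sum (I : Type) (r : seq I) (F : I -> R -> R[i]) :
  (forall i, past_poly (F i)) -> past_poly (fun l => \sum_(i <- r) F i l).
Proof.
move=> hF; elim: r => [|i r IH].
  by under eq_fun do rewrite big_nil; exact: past_poly0.
by under eq_fun do rewrite big_cons; exact: past_polyD.
Qed.

Lemma cintegrable_past_poly p : past_poly p -> cintegrable p.
Proof.
move=> [n [c ->]]; apply: cintegrable_sum => k.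
apply: cintegrableZ; exact: cintegrable_expi.
Qed.

Lemma past_poly_bounded p : past_poly p -> exists M : R, forall l, cabs (p l) <= M.
Proof.
move=> [n [c ->]]; exists (\sum_(k < n) cabs (c k)) => l.
apply: le_trans (cabs_sum _ _) _; apply: ler_sum => k _.
by rewrite cabsM cabs_expi mulr1.
Qed.

Definition fejerC n h (l : R) : R[i] :=
  (2 * pi)^-1%:C * cintegral (fun t => (fejerK n (l - t))%:C * h t).

Lemma fejerC_ReIm n h l : fejerC n h l =
  fejer n (fun t => complex.Re (h t)) l +i* fejer n (fun t => complex.Im (h t)) l.
Proof.
rewrite /fejerC /fejer cintegralE; apply: complexP.
  rewrite Re_mulc /= mul0r subr0; congr (_ * _); apply: rint_eq => t _.
  by rewrite Re_mulc /= mul0r subr0.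
rewrite Im_mulc /= mul0r addr0; congr (_ * _); apply: rint_eq => t _.
by rewrite Im_mulc /= mul0r addr0.
Qed.

Lemma fejerK_expi n (x : R) : (fejerK n x)%:C =
  \sum_(j < n) \sum_(k < n) (n%:R^-1)%:C * expi ((j%:R - k%:R) * x).
Proof.
rewrite fejerK_dirichlet real_complexM -mulc_conj mulr_suml mulr_sumr.
apply: eq_bigr => j _; rewrite conjc_sum mulr_sumr mulr_sumr; apply: eq_bigr => k _.
by rewrite conjc_expi -expiD -mulrBl.
Qed.

Lemma fejerC_expand n h l : cintegrable h -> fejerC n h l =
  \sum_(j < n) \sum_(k < n) (2 * pi)^-1%:C * ((n%:R^-1)%:C *
     cintegral (fun t => expi (- (j%:R - k%:R) * t) * h t)) * expi ((j%:R - k%:R) * l).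
Proof.
move=> ih.
pose F (j k : nat) t : R[i] := (n%:R^-1)%:C * expi ((j%:R - k%:R) * l) *
  (expi (- (j%:R - k%:R) * t) * h t).
have iF j k : cintegrable (F j k).
  by apply: cintegrableZ; exact: cintegrable_expiM.
rewrite /fejerC (@cintegral_eq _ _ (fun t => \sum_(j < n) \sum_(k < n) F j k t)).
  rewrite cintegral_sum; last by move=> j; exact: cintegrable_sum.
  rewrite mulr_sumr; apply: eq_bigr => j _.
  rewrite cintegral_sum// mulr_sumr; apply: eq_bigr => k _.
  by rewrite /F cintegralZ; [ring|exact: cintegrable_expiM].
move=> t; rewrite fejerK_expi mulr_suml; apply: eq_bigr => j _.
rewrite mulr_suml; apply: eq_bigr => k _.
rewrite /F mulrA -!mulrA; congr (_ * _); rewrite mulrA -expiD.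
by congr (expi _ * _); ring.
Qed.

(** The coefficient at frequency j - k is a multiple of the Fourier coefficient of [h] there, which
    vanishes by hypothesis when k <= j. Only frequencies -m with m >= 1 remain, and [past_poly]
    gives frequency -m the index m - 1. *)
Lemma past_poly_fejerC n h : cintegrable h ->
  (forall m : nat, cintegral (fun t => expi (- m%:R * t) * h t) = 0) ->
  past_poly (fejerC n h).
Proof.
move=> ih h0; rewrite (funext (fun l => fejerC_expand n l ih)).
apply: past_poly_sum => j; apply: past_poly_sum => k.
have [kj|jk] := leqP k j.
  rewrite -natrB// h0 !mulr0; under eq_fun do rewrite mul0r; exact: past_poly0.
apply: past_polyZ.
have -> : (j%:R - k%:R : R) = - (k - j).-1.+1%:R.
  by rewrite prednK ?subn_gt0// natrB ?(ltnW jk)// opprB.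
exact: past_poly_expi.
Qed.

End PastPolynomials.

(** * Approximation in weighted L2 *)

Section WeightedApproximation.
Context {R : realType}.
Implicit Types (h : R -> R[i]) (u w : R -> R).

(** The bounded part min(w, L) can be paired with L1 convergence; the remainder has small integral
    and will be multiplied by a bounded factor only. *)
Lemma rint_truncation w : rintegrable w -> (forall l, circle l -> 0 <= w l) ->
  forall e : R, 0 < e -> exists2 L : R, 0 < L & rint (fun l => w l - Num.min (w l) L) <= e.
Proof.
move=> iw w0 e e0.
have mw := rintegrable_measurable iw.
have mT (n : nat) : measurable_fun circle (fun l => w l - Num.min (w l) n.+1%:R).
  by apply: measurable_funB => //; exact: measurable_minr.
have bT (n : nat) l : circle l -> `|w l - Num.min (w l) n.+1%:R| <= w l.
  move=> cl; have wl := w0 l cl.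
  rewrite ger0_norm; last by rewrite subr_ge0 ge_min lexx.
  by rewrite gerBl le_min wl ler0n.
have iT n : rintegrable (fun l => w l - Num.min (w l) n.+1%:R).
  by apply: rintegrable_le iw (bT n).
have [||_ _] := @dominated_convergence _ _ _ (@lebesgue_measure R) _ measurable_circle
  (fun n l => (w l - Num.min (w l) n.+1%:R)%:E) (EFin \o cst 0) (EFin \o w)
  (fun n => measurable_int _ (iT n)) (measurable_int _ (rintegrable_cst 0)) _ iw _.
- apply: aeW => l _; apply: cvg_near_cst.
  have [N _ hN] := nbhs_infty_ger (w l); exists N => // n Nn /=.
  by rewrite (min_idPl _) ?subrr// (le_trans (hN n Nn))// ler_nat.
- by apply: aeW => l n cl; rewrite /= lee_fin; exact: bT.
rewrite (rint_EFin (rintegrable_cst 0)) rint_cst mul0r.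
under eq_fun do rewrite /= (rint_EFin (iT _)).
move=> /fine_cvgP[_] /cvgrPdist_le /(_ _ e0)[N _ /(_ N (leqnn N))] /=.
rewrite sub0r normrN => hN; exists N.+1%:R => //.
exact: le_trans (ler_norm _) hN.
Qed.

Lemma fejerC_weighted h w (M : R) : cmeasurable h -> ae_circle (fun l => cabs (h l) <= M) ->
  rintegrable w -> (forall l, circle l -> 0 <= w l) ->
  forall e : R, 0 < e -> exists n,
    rintegrable (fun l => cabs (h l - fejerC n.+1 h l) ^+ 2 * w l) /\
    rint (fun l => cabs (h l - fejerC n.+1 h l) ^+ 2 * w l) <= e.
Proof.
move=> mh hM iw w0 e e0.
have ih := cintegrable_bounded_ae mh hM; have [iR iI] := ih.
(* [h] contributes |M| and its Fejer mean 2 |M|, one for each of the real and imaginary parts; the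
   extra 1 keeps [B] positive for the divisions. *)
pose B : R := 3 * `|M| + 1.
have B0 : 0 < B by rewrite ltr_wpDl// mulr_ge0.
have iF n : cintegrable (fejerC n.+1 h).
  by split; under eq_fun do rewrite fejerC_ReIm /=; exact: rintegrable_fejer.
have bF n l : cabs (fejerC n.+1 h l) <= 2 * `|M|.
  apply: le_trans (cabs_le_ReIm _) _; rewrite fejerC_ReIm /= mulr_natl mulr2n.
  apply: lerD; apply: fejer_bounded => //; move: hM; apply: ae_circle_imp => t _ ht.
    by rewrite (le_trans (abs_Re_le _))// (le_trans ht)// ler_norm.
  by rewrite (le_trans (abs_Im_le _))// (le_trans ht)// ler_norm.
have bq n : ae_circle (fun l => cabs (h l - fejerC n.+1 h l) <= B).
  move: hM; apply: ae_circle_imp => l _ hl; apply: le_trans (cabsD _ _) _.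
  by rewrite cabsN; have := bF n l; have := ler_norm M; rewrite /B; lra.
have [|L L0 hL] := rint_truncation iw w0 (e := e / 2 / B ^+ 2).
  by rewrite !divr_gt0// exprn_gt0.
have LB0 : 0 < L * B by rewrite mulr_gt0.
have e4 : 0 < e / 2 / (L * B) / 2 by rewrite !divr_gt0.
have [N _ hN] : \forall n \near \oo,
    rint (fun l => `|fejer n.+1 (fun t => complex.Re (h t)) l - complex.Re (h l)|)
      <= e / 2 / (L * B) / 2
    /\ rint (fun l => `|fejer n.+1 (fun t => complex.Im (h t)) l - complex.Im (h l)|)
      <= e / 2 / (L * B) / 2.
  by move: (fejer_L1 iR e4) (fejer_L1 iI e4); apply: filterS2 => n.
have [hR hI] := hN N (leqnn N); exists N.
have iq : cintegrable (fun l => h l - fejerC N.+1 h l) by exact: cintegrableB.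
have mq := measurable_cabs_sqr (cintegrable_measurable iq).
have mw := rintegrable_measurable iw.
have iT : rintegrable (fun l => w l - Num.min (w l) L).
  apply: rintegrable_le iw _.
    by apply: measurable_funB => //; exact: measurable_minr.
  move=> l cl; rewrite ger0_norm; last by rewrite subr_ge0 ge_min lexx.
  by rewrite gerBl le_min w0// ltW.
have iB : rintegrable (fun l => B ^+ 2 * (w l - Num.min (w l) L)
                     + L * B * cabs (h l - fejerC N.+1 h l)).
  by apply: rintegrableD; apply: rintegrableZ => //; exact: cintegrable_cabs.
(* With y <= B the distance and m = min(w, L), y^2 w splits into y^2 (w - m) <= B^2 (w - m) and y^2
   m <= L B y, so only the L1 distance has to be small. *)
have key : ae_circle (fun l => cabs (h l - fejerC N.+1 h l) ^+ 2 * w l <=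
   B ^+ 2 * (w l - Num.min (w l) L) + L * B * cabs (h l - fejerC N.+1 h l)).
  move: (bq N); apply: ae_circle_imp => l cl.
  set y := cabs _ => hy; have y0 : 0 <= y := cabs_ge0 _; have wl := w0 l cl.
  set m := Num.min _ _.
  have mL : m <= L by rewrite ge_min lexx orbT.
  have mw' : m <= w l by rewrite ge_min lexx.
  have m0 : 0 <= m by rewrite le_min wl ltW.
  rewrite (_ : y ^+ 2 * w l = y ^+ 2 * (w l - m) + y ^+ 2 * m); last by ring.
  apply: lerD.
    by apply: ler_wpM2r; rewrite ?subr_ge0// ler_sqr ?nnegrE// ltW.
  rewrite expr2 mulrC mulrA ler_wpM2r//; apply: ler_pM => //.
have iqw : rintegrable (fun l => cabs (h l - fejerC N.+1 h l) ^+ 2 * w l).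
  apply: rintegrable_le_ae iB _; first exact: measurable_funM.
  move: key; apply: ae_circle_imp => l cl hl.
  by rewrite ger0_norm// mulr_ge0 ?sqr_ge0 ?w0.
split => //; apply: le_trans (rint_le_ae iqw iB key) _.
have icq := cintegrable_cabs iq.
rewrite rintD; [|exact: rintegrableZ..]; rewrite !rintZ//.
have iaR : rintegrable (fun l =>
    `|fejer N.+1 (fun t => complex.Re (h t)) l - complex.Re (h l)|).
  by apply: rintegrable_abs; apply: rintegrableB => //; exact: rintegrable_fejer.
have iaI : rintegrable (fun l =>
    `|fejer N.+1 (fun t => complex.Im (h t)) l - complex.Im (h l)|).
  by apply: rintegrable_abs; apply: rintegrableB => //; exact: rintegrable_fejer.
have hq : rint (fun l => cabs (h l - fejerC N.+1 h l)) <= e / 2 / (L * B).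
  apply: (@le_trans _ _ (rint (fun l =>
      `|fejer N.+1 (fun t => complex.Re (h t)) l - complex.Re (h l)|
    + `|fejer N.+1 (fun t => complex.Im (h t)) l - complex.Im (h l)|))).
    apply: rint_le => //; first exact: rintegrableD.
    move=> l _; rewrite -cabsN opprB; apply: le_trans (cabs_le_ReIm _) _.
    by rewrite ReD ImD ReN ImN fejerC_ReIm.
  by rewrite rintD// [leRHS]splitr lerD.
rewrite [leRHS]splitr lerD//.
  by rewrite mulrC -ler_pdivlMr// exprn_gt0.
by rewrite mulrC -ler_pdivlMr.
Qed.

(** Neither the bound on [h] nor its orthogonality involves the densities, so one such function lies
    in [L2past f g] for all [g] at once, as membership in [HD] demands. *)
Lemma L2past_bounded f g h (M : R) : spectral_density f -> spectral_density g ->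
  cmeasurable h -> ae_circle (fun l => cabs (h l) <= M) ->
  (forall m : nat, cintegral (fun t => expi (- m%:R * t) * h t) = 0) ->
  L2past f g h.
Proof.
move=> [f0 if_] [g0 ig] mh hM hz.
have iw : rintegrable (fun l => f l + g l) by exact: rintegrableD.
have w0 l : circle l -> 0 <= f l + g l by move=> cl; rewrite addr_ge0 ?f0 ?g0.
split => //.
- have ihw : rintegrable (fun l => cabs (h l) ^+ 2 * (f l + g l)).
    apply: (@rintegrableM_bounded _ _ _ (M ^+ 2)) => //; first exact: measurable_cabs_sqr.
    move: hM; apply: ae_circle_imp => l _ hl; rewrite ger0_norm ?sqr_ge0//.
    by rewrite ler_sqr ?nnegrE ?cabs_ge0// (le_trans (cabs_ge0 _) hl).
  by rewrite /sqnormL2 (rint_EFin ihw) ltry.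
- move=> e e0; have e2 : 0 < e / 2 by lra.
  have [n [iq hq]] := fejerC_weighted mh hM iw w0 e2.
  exists (fejerC n.+1 h).
    by apply: past_poly_fejerC => //; exact: cintegrable_bounded_ae hM.
  by rewrite /sqnormL2 (rint_EFin iq) lte_fin; lra.
Qed.

End WeightedApproximation.

(** * The Wiener filter and its optimality *)

Section OptimalCharacteristic.
Context {R : realType}.
Variables (a : nat -> R[i]) (f g : R -> R) (C : R -> R[i]) (M : R).
Hypotheses (ha : cvgn (series (fun j => cabs (a j))))
  (hf : spectral_density f) (hg : spectral_density g)
  (hadm : admissible f g) (hC : is_L2_sum (spectralC a f g) C).

Let s l := f l + g l.
Let phi l := (f l + g l)^-1.
Let r l := f l / (f l + g l).

Definition wiener_char l : R[i] := (Afun a l * (f l)%:C - C l) / (f l + g l)%:C.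

Local Notation h0 := wiener_char.

Hypothesis hM : ae_circle (fun l => cabs (h0 l) <= M).

Let f0 l : circle l -> 0 <= f l. Proof. by case: hf => + _; exact. Qed.
Let g0 l : circle l -> 0 <= g l. Proof. by case: hg => + _; exact. Qed.
Let if_ : rintegrable f. Proof. by case: hf. Qed.
Let ig : rintegrable g. Proof. by case: hg. Qed.
Let s0 l : circle l -> 0 <= s l.
Proof. by move=> cl; rewrite addr_ge0 ?f0 ?g0. Qed.
Let is_ : rintegrable s. Proof. exact: rintegrableD. Qed.

Lemma ae_density_gt0 : ae_circle (fun l => 0 < f l + g l).
Proof.
have [ii _ _] := hadm.
have := integrable_ae (mu := @lebesgue_measure R) measurable_circle ii.
apply: ae_circle_imp => l cl h.
rewrite lt_neqAle (s0 cl) andbT eq_sym; apply/eqP => e; move: h.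
by rewrite e inver eqxx.
Qed.

Let s_gt0 := ae_density_gt0.

Lemma measurable_inv_density : measurable_fun circle (fun l => (f l + g l)^-1).
Proof.
have [ii _ _] := hadm; have mi := measurable_int (@lebesgue_measure R) ii.
rewrite (_ : (fun l => _) = fine \o (fun l => ((f l + g l)%:E^-1)%E)).
  exact: measurableT_comp.
by apply/funext => l /=; rewrite fine_invr.
Qed.

(** Where f + g vanishes the real inverse is 0 and the extended one is +oo, so the former is
    dominated at every point. *)
Lemma rintegrable_inv_density : rintegrable (fun l => (f l + g l)^-1).
Proof.
have [ii _ _] := hadm; have mi := measurable_int (@lebesgue_measure R) ii.
apply: (le_integrable (mu := @lebesgue_measure R) measurable_circle _ _ ii).
  by apply/measurable_EFinP; exact: measurable_inv_density.
move=> l cl /=; have [->|n0] := eqVneq (f l + g l) 0.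
  by rewrite inver eqxx leey.
by rewrite inver (negbTE n0).
Qed.

Let iphi := rintegrable_inv_density.

Lemma measurable_ratio : measurable_fun circle (fun l => f l / (f l + g l)).
Proof.
apply: measurable_funM; last exact: measurable_inv_density.
exact: rintegrable_measurable.
Qed.

Lemma ratio_bound l : circle l -> 0 <= f l / (f l + g l) <= 1.
Proof.
move=> cl; have fl := f0 cl; have gl := g0 cl; rewrite divr_ge0 ?addr_ge0//=.
have [->|n0] := eqVneq (f l + g l) 0; first by rewrite invr0 mulr0.
by rewrite ler_pdivrMr ?mul1r ?lerDl// lt_neqAle eq_sym n0 addr_ge0.
Qed.

Let rb : ae_circle (fun l => `|r l| <= 1).
Proof.
by apply: ae_circleW => l /ratio_bound /andP[r0 r1]; rewrite ger0_norm.
Qed.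

Let ir : rintegrable r.
Proof. by apply: rintegrable_bounded_ae rb; exact: measurable_ratio. Qed.

Let mA := cmeasurable_Afun ha.

Let iC := cintegrable_L2_sum hC.
Let mC := cintegrable_measurable iC.

Let Ar l : R[i] := Afun a l * (r l)%:C.

Let mAr : cmeasurable Ar.
Proof. by apply: cmeasurableM => //; apply: cmeasurable_real; exact: measurable_ratio. Qed.

Let Arb : ae_circle (fun l => cabs (Ar l) <= abs_tail a 0).
Proof.
move: rb; apply: ae_circle_imp => l _ rl; rewrite cabsM cabs_real.
by rewrite -[leRHS]mulr1 ler_pM ?cabs_ge0//; exact: Afun_bounded.
Qed.

Lemma mxop_opR_Afun : mxop (opR f g) a = fcoef Ar.
Proof. by apply/funext => j; rewrite mxop_toeplitz_l1. Qed.

(** [mxinv] picks a solution only if one exists. Existence holds because R a is in l2, its entries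
    being Fourier coefficients of the bounded function A f / (f + g). *)
Lemma spectralC_spec : ell2 (spectralC a f g) /\
  mxop (opB f g) (spectralC a f g) = mxop (opR f g) a.
Proof.
have [_ _ [T [[K hK] hT]]] := hadm.
have e2 : ell2 (mxop (opR f g) a) by rewrite mxop_opR_Afun; exact: bessel Arb.
apply: (@xgetPex _ _ [set x | ell2 x /\ mxop (opB f g) x = mxop (opR f g) a]).
exists (T (mxop (opR f g) a)); split; first by have [] := hK _ e2.
by have [] := hT _ e2.
Qed.

Lemma wiener_charE l : h0 l = Ar l - (phi l)%:C * C l.
Proof.
rewrite /wiener_char /Ar /r /phi -(fmorphV (real_complex R)) real_complexM.
by rewrite mulrBl mulrA [X in _ - X]mulrC.
Qed.

Lemma cmeasurable_wiener : cmeasurable h0.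
Proof.
rewrite (funext wiener_charE); apply: cmeasurableB => //; apply: cmeasurableM => //.
by apply: cmeasurable_real; exact: measurable_inv_density.
Qed.

Let mh := cmeasurable_wiener.
Let ih : cintegrable h0 := cintegrable_bounded_ae mh hM.

Lemma fcoef_wiener j : fcoef h0 j = 0.
Proof.
have [_ hB _] := hadm; have [K hK] := toeplitz_symbol_bounded iphi hB.
have hK' : ae_circle (fun l => `|phi l| <= K).
  by move: hK; apply: ae_circle_imp => l cl; rewrite ger0_norm// invr_ge0 s0.
have iPC : cintegrable (fun l => (phi l)%:C * C l).
  apply: (@cintegrableM_bounded _ _ _ K) => //.
    by apply: cmeasurable_real; exact: measurable_inv_density.
  by move: hK'; apply: ae_circle_imp => l _; rewrite cabs_real.
have iAr : cintegrable Ar := cintegrable_bounded_ae mAr Arb.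
have [_ e] := spectralC_spec.
have := congr1 (fun y : nat -> R[i] => y j) e.
rewrite mxop_opR_Afun (mxop_toeplitz_L2 j iphi hK' hC) => {}e.
transitivity (fcoef Ar j - fcoef (fun l => (phi l)%:C * C l) j); last by rewrite e subrr.
rewrite /fcoef -mulrBr -cintegralB; [|exact: cintegrable_expiM..].
by congr (_ * _); apply: cintegral_eq => l; rewrite wiener_charE mulrBr.
Qed.

Lemma wiener_orth m : cintegral (fun l => expi (- m%:R * l) * h0 l) = 0.
Proof.
have /eqP := fcoef_wiener m; rewrite mulf_eq0 => /orP[|/eqP//].
rewrite fmorph_eq0 invr_eq0.
by rewrite gt_eqF// twopi_gt0.
Qed.

(** [C] is an L2 limit of combinations of nonnegative frequencies, each orthogonal to [h0];
    boundedness of [h0] allows the passage to the limit. *)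
Lemma wiener_orthC : cintegral (fun l => h0 l * conjc (C l)) = 0.
Proof.
have := inner_fcoef_L2 mh hM hC.
rewrite (_ : inner _ _ = 0); last first.
  apply: ccvg_csum; rewrite (_ : (fun n => _) = fun=> 0); first exact: ccvg_cst.
  by apply/funext => n; rewrite big1// => k _; rewrite fcoef_wiener mul0r.
move=> /esym /eqP; rewrite mulf_eq0 => /orP[|/eqP//].
rewrite fmorph_eq0 invr_eq0.
by rewrite gt_eqF// twopi_gt0.
Qed.

Lemma past_poly_orthC p : past_poly p -> cintegral (fun l => C l * conjc (p l)) = 0.
Proof.
move=> [n [c ->]].
rewrite (@cintegral_eq _ _ (fun l => \sum_(k < n) conjc (c k) * (expi (k.+1%:R * l) * C l))).
  rewrite cintegral_sum; last by move=> k; apply: cintegrableZ; exact: cintegrable_expiM.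
  rewrite big1// => k _; rewrite cintegralZ; last exact: cintegrable_expiM.
  rewrite (_ : cintegral _ = 0) ?mulr0//.
  have mE := @cmeasurable_expi R k.+1%:R.
  have bE : ae_circle (fun l : R => cabs (expi (k.+1%:R * l)) <= 1).
    by apply: ae_circleW => l _; rewrite cabs_expi.
  apply: ccvg_unique (ccvg_cintegral_L2 hC mE bE) _.
  rewrite (_ : (fun m => _) = fun=> 0); first exact: ccvg_cst.
  apply/funext => m; set x := spectralC a f g.
  (* The zero is kept as a second index so that [cintegral_expi] applies; the two indices differ
     because [j + k.+1] is positive. *)
  rewrite (@cintegral_eq _ _ (fun l => \sum_(j < m) x j * expi (((j + k.+1)%:R - 0%:R) * l))).
    rewrite cintegral_sum; last by move=> j; apply: cintegrableZ; exact: cintegrable_expi.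
    rewrite big1// => j _; rewrite cintegralZ; last exact: cintegrable_expi.
    by rewrite cintegral_expi addnS mulr0.
  move=> l; rewrite /psum mulr_sumr; apply: eq_bigr => j _.
  by rewrite mulrCA -expiD; congr (_ * expi _); rewrite natrD; ring.
move=> l; rewrite conjc_sum mulr_sumr; apply: eq_bigr => k _.
by rewrite conjcM conjc_expi mulNr opprK; ring.
Qed.

Lemma rintegrable_sqr_weight h w (K : R) : cmeasurable h ->
  ae_circle (fun l => cabs (h l) <= K) -> rintegrable w ->
  rintegrable (fun l => cabs (h l) ^+ 2 * w l).
Proof.
move=> mk hK iw.
apply: (@rintegrableM_bounded _ _ _ (K ^+ 2)) => //; first exact: measurable_cabs_sqr.
move: hK; apply: ae_circle_imp => l _ hl; rewrite ger0_norm ?sqr_ge0//.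
by rewrite ler_sqr ?nnegrE ?cabs_ge0// (le_trans (cabs_ge0 _) hl).
Qed.

Lemma sqr_error_bounded h (K : R) : ae_circle (fun l => cabs (h l) <= K) ->
  ae_circle (fun l => cabs (Afun a l - h l) <= abs_tail a 0 + K).
Proof.
apply: ae_circle_imp => l _ hl; apply: le_trans (cabsD _ _) _.
by rewrite cabsN lerD//; exact: Afun_bounded.
Qed.

Lemma Delta_rint h (w : R -> R) :
  rintegrable (fun l => cabs (Afun a l - h l) ^+ 2 * f l) ->
  rintegrable (fun l => cabs (h l) ^+ 2 * w l) ->
  Delta a h f w = ((2 * pi)^-1 * (rint (fun l => cabs (Afun a l - h l) ^+ 2 * f l)
     + rint (fun l => cabs (h l) ^+ 2 * w l)))%:E.
Proof.
by move=> i1 i2; rewrite /Delta /sqnormL2 (rint_EFin i1) (rint_EFin i2) -!EFinM -EFinD -mulrDr.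
Qed.

Let err h : R := rint (fun l => cabs (Afun a l - h l) ^+ 2 * f l)
     + rint (fun l => cabs (h l) ^+ 2 * g l).

(* Both integrands differ by the square norm of p - h0 in L2(f+g) and a cross
   term in C, which vanishes by the two orthogonality relations above. *)
Lemma err_past_poly p : past_poly p -> err h0 <= err p.
Proof.
move=> pp; have ip := cintegrable_past_poly pp; have mp := cintegrable_measurable ip.
have [K pK] := past_poly_bounded pp.
have aK : ae_circle (fun l => cabs (p l) <= K) by exact: ae_circleW.
have ib h L : cmeasurable h -> ae_circle (fun l => cabs (h l) <= L) ->
    rintegrable (fun l => cabs (Afun a l - h l) ^+ 2 * f l) /\
    rintegrable (fun l => cabs (h l) ^+ 2 * g l).
  move=> mk hL; split; last exact: rintegrable_sqr_weight hL ig.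
  by apply: rintegrable_sqr_weight (sqr_error_bounded hL) if_; exact: cmeasurableB.
have [p1 p2] := ib _ _ mp aK; have [q1 q2] := ib _ _ mh hM.
have icp : cintegrable (fun l => C l * conjc (p l)).
  under eq_fun do rewrite mulrC; apply: (@cintegrableM_bounded _ _ _ K) => //.
    exact: cmeasurable_conj.
  by move: aK; apply: ae_circle_imp => l _; rewrite cabs_conj.
have ihc : cintegrable (fun l => h0 l * conjc (C l)).
  by apply: (cintegrableM_bounded mh hM); exact: cintegrable_conj.
have iX : rintegrable (fun l => complex.Re (C l * conjc (p l))) by case: icp.
have iY : rintegrable (fun l => complex.Re (h0 l * conjc (C l))) by case: ihc.
have X0 : rint (fun l => complex.Re (C l * conjc (p l))) = 0.
  by have := congr1 (@complex.Re R) (past_poly_orthC pp).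
have Y0 : rint (fun l => complex.Re (h0 l * conjc (C l))) = 0.
  by have := congr1 (@complex.Re R) wiener_orthC.
rewrite /err -!rintD//.
have -> : rint (fun l => cabs (Afun a l - h0 l) ^+ 2 * f l + cabs (h0 l) ^+ 2 * g l) =
  rint (fun l => cabs (Afun a l - h0 l) ^+ 2 * f l + cabs (h0 l) ^+ 2 * g l +
    (2 * complex.Re (h0 l * conjc (C l)) - 2 * complex.Re (C l * conjc (p l)))).
  rewrite [RHS]rintD; last first.
    by apply: rintegrableB; exact: rintegrableZ.
    exact: rintegrableD.
  rewrite [X in _ = _ + X]rintB; [|exact: rintegrableZ..].
  by rewrite !rintZ// X0 Y0 !mulr0 subrr addr0.
apply: rint_le_ae.
- apply: rintegrableD; first exact: rintegrableD.
  by apply: rintegrableB; exact: rintegrableZ.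
- exact: rintegrableD.
move: s_gt0; apply: ae_circle_imp => l _ sl.
have E : Afun a l * (f l)%:C - C l = h0 l * (s l)%:C.
  by rewrite /wiener_char divfK// fmorph_eq0 gt_eqF.
have {E} E : C l = Afun a l * (f l)%:C - h0 l * (s l)%:C by rewrite -E; ring.
rewrite E -subr_ge0.
rewrite (_ : _ - _ = cabs (p l - h0 l) ^+ 2 * s l).
  by rewrite mulr_ge0 ?sqr_ge0// ltW.
rewrite /s !cabs_sqr; case: (Afun a l) (h0 l) (p l) => [a1 a2] [h1 h2] [c1 c2] /=.
ring.
Qed.

(** Young's inequality in place of the triangle inequality in L2: the factor 1 + e tends to 1, and
    the large factor 1 + e^-1 falls on the part that can be made small. *)
Lemma sqrD_le (e : R) (z w : R[i]) : 0 < e ->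
  cabs (z + w) ^+ 2 <= (1 + e) * cabs z ^+ 2 + (1 + e^-1) * cabs w ^+ 2.
Proof.
move=> e0; rewrite !cabs_sqr ReD ImD.
have key (x y : R) : (x + y) ^+ 2 <= (1 + e) * x ^+ 2 + (1 + e^-1) * y ^+ 2.
  have : 0 <= e^-1 * (e * x - y) ^+ 2 by rewrite mulr_ge0 ?sqr_ge0// invr_ge0 ltW.
  have -> : e^-1 * (e * x - y) ^+ 2 = e * x ^+ 2 - 2 * (x * y) + e^-1 * y ^+ 2.
    by field; rewrite gt_eqF.
  lra.
by have := key (complex.Re z) (complex.Re w); have := key (complex.Im z) (complex.Im w); lra.
Qed.

(** Optimality against polynomials passes to [L2past f g] by density; smallness in L2(f + g)
    controls the weights [f] and [g] separately. *)
Lemma wiener_optimal h : L2past f g h -> (Delta a h0 f g <= Delta a h f g)%E.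
Proof.
move=> [mk hfin happ].
have mf := rintegrable_measurable if_; have mg := rintegrable_measurable ig.
have ms := rintegrable_measurable is_.
have ihs : rintegrable (fun l => cabs (h l) ^+ 2 * s l) by exact: sqnormL2_lty hfin.
have le_f k : cmeasurable k -> rintegrable (fun l => cabs (k l) ^+ 2 * s l) ->
    rintegrable (fun l => cabs (k l) ^+ 2 * f l) /\
    rintegrable (fun l => cabs (k l) ^+ 2 * g l).
  move=> mk' i; have mk2 := measurable_cabs_sqr mk'.
  split; apply: (rintegrable_le _ i); try exact: measurable_funM.
    move=> l cl; rewrite ger0_norm; last by rewrite mulr_ge0 ?sqr_ge0 ?f0.
    by apply: ler_wpM2l; [exact: sqr_ge0|rewrite /s lerDl g0].
  move=> l cl; rewrite ger0_norm; last by rewrite mulr_ge0 ?sqr_ge0 ?g0.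
  by apply: ler_wpM2l; [exact: sqr_ge0|rewrite /s lerDr f0].
have [ihf ihg] := le_f _ mk ihs.
have iAf : rintegrable (fun l => cabs (Afun a l) ^+ 2 * f l).
  apply: (@rintegrable_sqr_weight _ _ (abs_tail a 0)) => //.
  by apply: ae_circleW => l _; exact: Afun_bounded.
have iAhf : rintegrable (fun l => cabs (Afun a l - h l) ^+ 2 * f l).
  apply: (@rintegrable_le _ _ (fun l => (1 + 1) * (cabs (Afun a l) ^+ 2 * f l) +
     (1 + 1^-1) * (cabs (h l) ^+ 2 * f l))).
  - by apply: measurable_funM => //; apply: measurable_cabs_sqr; exact: cmeasurableB.
  - by apply: rintegrableD; exact: rintegrableZ.
  - move=> l cl; rewrite ger0_norm; last by rewrite mulr_ge0 ?sqr_ge0 ?f0.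
    rewrite ![_ * (_ * f l)]mulrA -mulrDl; apply: ler_wpM2r; first exact: f0.
    have h1 := sqrD_le (Afun a l) (- h l) (@ltr01 R).
    by rewrite cabsN in h1.
have iAh0 : rintegrable (fun l => cabs (Afun a l - h0 l) ^+ 2 * f l).
  by apply: rintegrable_sqr_weight (sqr_error_bounded hM) if_; exact: cmeasurableB.
have ih0 : rintegrable (fun l => cabs (h0 l) ^+ 2 * g l).
  exact: rintegrable_sqr_weight hM ig.
rewrite !Delta_rint// lee_fin; apply: ler_wpM2l.
  by rewrite invr_ge0 ltW// twopi_gt0.
rewrite -/(err h0) -/(err h); set X := err h.
have X0 : 0 <= X.
  by rewrite addr_ge0//; apply: rint_ge0 => l cl; rewrite mulr_ge0 ?sqr_ge0 ?f0 ?g0.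
have bound e : 0 < e -> e <= 1 -> err h0 <= X + e * (X + 2).
  move=> e0 e1.
  (* The tolerance e^2 offsets the factor 1 + e^-1: their product e (1 + e) is at most 2 e since e
     <= 1, which is the 2 in the bound. *)
  have [p pp hp] := happ (e ^+ 2) (exprn_gt0 _ e0).
  have mp := cintegrable_measurable (cintegrable_past_poly pp).
  have md : cmeasurable (fun l => h l - p l) by exact: cmeasurableB.
  have ids : rintegrable (fun l => cabs (h l - p l) ^+ 2 * s l).
    apply: (sqnormL2_lty md ms s0); apply: lt_trans hp _; exact: ltry.
  have [idf idg] := le_f _ md ids.
  rewrite /sqnormL2 (rint_EFin ids) lte_fin in hp.
  have [K pK] := past_poly_bounded pp.
  have aK : ae_circle (fun l => cabs (p l) <= K) by exact: ae_circleW.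
  have ip1 : rintegrable (fun l => cabs (Afun a l - p l) ^+ 2 * f l).
    by apply: rintegrable_sqr_weight (sqr_error_bounded aK) if_; exact: cmeasurableB.
  have ip2 : rintegrable (fun l => cabs (p l) ^+ 2 * g l).
    exact: rintegrable_sqr_weight aK ig.
  apply: le_trans (err_past_poly pp) _.
  have h1 : rint (fun l => cabs (Afun a l - p l) ^+ 2 * f l) <=
      (1 + e) * rint (fun l => cabs (Afun a l - h l) ^+ 2 * f l) +
      (1 + e^-1) * rint (fun l => cabs (h l - p l) ^+ 2 * f l).
    rewrite -!rintZ// -rintD; [|exact: rintegrableZ..].
    apply: rint_le => //; first by apply: rintegrableD; exact: rintegrableZ.
    move=> l cl; rewrite ![_ * (_ * f l)]mulrA -mulrDl; apply: ler_wpM2r; first exact: f0.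
    apply: le_trans (sqrD_le _ _ e0); rewrite addrA subrK//.
  have h2 : rint (fun l => cabs (p l) ^+ 2 * g l) <=
      (1 + e) * rint (fun l => cabs (h l) ^+ 2 * g l) +
      (1 + e^-1) * rint (fun l => cabs (h l - p l) ^+ 2 * g l).
    rewrite -!rintZ// -rintD; [|exact: rintegrableZ..].
    apply: rint_le => //; first by apply: rintegrableD; exact: rintegrableZ.
    move=> l cl; rewrite ![_ * (_ * g l)]mulrA -mulrDl; apply: ler_wpM2r; first exact: g0.
    rewrite -[cabs (h l - p l)]cabsN; apply: le_trans (sqrD_le _ _ e0).
    by rewrite opprB addrC subrK.
  have h3 : rint (fun l => cabs (h l - p l) ^+ 2 * f l) +
            rint (fun l => cabs (h l - p l) ^+ 2 * g l) <= e ^+ 2.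
    rewrite -rintD//; apply: le_trans (ltW hp).
    by rewrite le_eqVlt; apply/orP; left; apply/eqP/rint_eq => l _; rewrite /s; ring.
  have h4 : (1 + e^-1) * (rint (fun l => cabs (h l - p l) ^+ 2 * f l) +
            rint (fun l => cabs (h l - p l) ^+ 2 * g l)) <= e * 2.
    apply: (@le_trans _ _ ((1 + e^-1) * e ^+ 2)).
      by rewrite ler_wpM2l// addr_ge0// invr_ge0 ltW.
    have -> : (1 + e^-1) * e ^+ 2 = e * (1 + e) by field; rewrite gt_eqF.
    by rewrite ler_pM2l//; lra.
  rewrite /err; apply: le_trans (lerD h1 h2) _.
  rewrite {1}/X /err; move: h4; rewrite /X /err.
  set x1 := rint _; set x2 := rint _; set x3 := rint _; set x4 := rint _.
  by move=> h4; lra.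
apply/ler_addgt0Pr => d d0.
pose e : R := Num.min 1 (d / (X + 2)).
have X2 : 0 < X + 2 by lra.
have e0 : 0 < e by rewrite lt_min ltr01 divr_gt0.
have e1 : e <= 1 by rewrite ge_min lexx.
apply: (le_trans (bound e e0 e1)); rewrite lerD2l -ler_pdivlMr//.
by rewrite ge_min lexx orbT.
Qed.

End OptimalCharacteristic.

(** * Scaling of operators, inverses and series *)

Section Scaling.
Context {R : realType}.
Implicit Types (u x y : nat -> R[i]) (M : nat -> nat -> R[i]) (k : R).

Definition scalemx k M : nat -> nat -> R[i] := fun i j => k%:C * M i j.
Definition scalec k x : nat -> R[i] := fun j => k%:C * x j.

Lemma cabs_scalec k x j : cabs (scalec k x j) ^+ 2 = k ^+ 2 * cabs (x j) ^+ 2.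
Proof. by rewrite /scalec cabsM cabs_real exprMn real_normK// num_real. Qed.

Lemma series_scalec k x : series (fun j => cabs (scalec k x j) ^+ 2) =
  fun n => k ^+ 2 * series (fun j => cabs (x j) ^+ 2) n.
Proof.
apply/funext => n; rewrite /series /= mulr_sumr; apply: eq_bigr => j _.
exact: cabs_scalec.
Qed.

Lemma ell2_scale k x : ell2 x -> ell2 (scalec k x).
Proof.
rewrite /ell2 series_scalec => h.
apply/cvg_ex; eexists; apply: cvgM; [exact: cvg_cst|exact: h].
Qed.

Lemma ell2norm_scale k x : 0 <= k -> ell2 x -> ell2norm (scalec k x) = k * ell2norm x.
Proof.
move=> k0 h; rewrite /ell2norm series_scalec.
rewrite (_ : limn _ = k ^+ 2 * limn (series (fun j => cabs (x j) ^+ 2))).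
  by rewrite sqrtrM ?sqr_ge0// sqrtr_sqr ger0_norm.
by apply/cvg_lim => //; apply: cvgM; [exact: cvg_cst|exact: h].
Qed.

Lemma ccvg_csummable u z : ccvg (fun n => \sum_(j < n) u j) z -> csummable u.
Proof.
rewrite /csummable; have [-> ->] := series_ReIm u.
by move=> /ccvg_ReIm[h1 h2]; split; apply/cvg_ex; eexists; [exact: h1|exact: h2].
Qed.

Lemma csum_scale k u : csummable u -> csummable (fun j => k%:C * u j) /\
  csum (fun j => k%:C * u j) = k%:C * csum u.
Proof.
move=> /csummable_ccvg h.
have h' : ccvg (fun n => \sum_(j < n) k%:C * u j) (k%:C * csum u).
  by under eq_fun do rewrite -mulr_sumr; exact: ccvgZ.
by split; [exact: ccvg_csummable h'|exact: ccvg_csum].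
Qed.

Lemma mxop_scale k M x : (forall j, csummable (fun i => M j i * x i)) ->
  mxop (scalemx k M) x = scalec k (mxop M x).
Proof.
move=> h; apply/funext => j; rewrite /mxop /scalemx /scalec.
under eq_fun do rewrite -mulrA.
by have [_ ->] := csum_scale k (h j).
Qed.

Lemma scalecK k x : k != 0 -> scalec k^-1 (scalec k x) = x.
Proof.
move=> k0; apply/funext => j.
by rewrite /scalec mulrA -real_complexM mulVf// mul1r.
Qed.

Lemma scalecVK k x : k != 0 -> scalec k (scalec k^-1 x) = x.
Proof.
move=> k0; apply/funext => j.
by rewrite /scalec mulrA -real_complexM mulfV// mul1r.
Qed.

Lemma mx_bounded_scale k M : 0 <= k -> mx_bounded M -> mx_bounded (scalemx k M).
Proof.
move=> k0 [hs [K hK]]; split.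
  move=> x ex j; rewrite /scalemx; under eq_fun do rewrite -mulrA.
  by have [] := csum_scale k (hs x ex j).
exists (k * K) => x ex; have [h1 h2] := hK x ex.
rewrite mxop_scale; last exact: hs.
split; first exact: ell2_scale.
by rewrite ell2norm_scale// -mulrA ler_wpM2l.
Qed.

Lemma mx_bounded_inverse_scale k M : 0 < k -> mx_bounded M -> mx_bounded_inverse M ->
  mx_bounded_inverse (scalemx k M).
Proof.
move=> k0 [hs hM] [T [[K hK] hT]]; have kn : k != 0 by rewrite gt_eqF.
exists (fun y => T (scalec k^-1 y)); split.
  exists (K * k^-1) => y ey; have [h1 h2] := hK _ (ell2_scale (k := k^-1) ey).
  split => //; rewrite -mulrA -ell2norm_scale//.
  by rewrite invr_ge0 ltW.
move=> x ex; have [h1 h2] := hT x ex; split.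
  by rewrite mxop_scale ?scalecK//; exact: hs.
have ek := ell2_scale (k := k^-1) ex; have [_ h3] := hT _ ek.
have [eT _] := hK _ ek.
by rewrite mxop_scale ?h3 ?scalecVK//; exact: hs.
Qed.

(** The two systems have the same solution set, so the choice made by [mxinv] is the same whether or
    not that set is empty. *)
Lemma mxinv_scale k M y : k != 0 -> mx_bounded M ->
  mxinv (scalemx k M) (scalec k y) = mxinv M y.
Proof.
move=> k0 [hs _]; rewrite /mxinv; congr xget; apply/seteqP; split=> x /= [ex h]; split=> //.
  rewrite mxop_scale in h; last exact: hs.
  by rewrite -(scalecK (mxop M x) k0) h scalecK.
by rewrite mxop_scale ?h//; exact: hs.
Qed.

Lemma toeplitz_scale k (phi psi : R -> R) : rintegrable phi ->
  (forall l, circle l -> psi l = k * phi l) ->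
  toeplitz psi = scalemx k (toeplitz phi).
Proof.
move=> iphi h; apply/funext => i; apply/funext => j.
rewrite /scalemx /toeplitz mulrCA; congr (_ * _).
rewrite -cintegralZ; last by apply: cintegrable_expiM; exact: cintegrable_real.
rewrite !cintegralE; apply: complexP; apply: rint_eq => l cl; rewrite h//.
  by rewrite real_complexM; congr complex.Re; ring.
by rewrite real_complexM; congr complex.Im; ring.
Qed.

Lemma csummable_toeplitz_l1 (a : nat -> R[i]) (phi : R -> R) j :
  cvgn (series (fun j => cabs (a j))) -> rintegrable phi ->
  csummable (fun i => toeplitz phi j i * a i).
Proof.
move=> ha iphi; have ic := cintegrable_expiM (- j%:R) (cintegrable_real iphi).
have h := ccvgZ ((2 * pi)^-1)%:C (ccvg_cintegral_Afun ha ic).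
by apply: ccvg_csummable; under eq_fun do rewrite toeplitz_sum//; exact: h.
Qed.

End Scaling.

(** * The perturbed density and the slack power constraint *)

Section LeastFavourable.
Context {R : realType}.
Variables (a : nat -> R[i]) (f g0 : R -> R) (C : R -> R[i]) (M P : R).
Hypotheses (ha : cvgn (series (fun j => cabs (a j))))
  (hf : spectral_density f) (hg : spectral_density g0)
  (hadm : admissible f g0) (hC : is_L2_sum (spectralC a f g0) C).

Let s l := f l + g0 l.
Let phi l := (f l + g0 l)^-1.
Let r l := f l / (f l + g0 l).
Let q l := f l * g0 l / (f l + g0 l).
Local Notation h0 := (wiener_char a f g0 C).

Hypothesis hM : ae_circle (fun l => cabs (h0 l) <= M).

Let fge0 l : circle l -> 0 <= f l. Proof. by case: hf => + _; exact. Qed.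
Let gge0 l : circle l -> 0 <= g0 l. Proof. by case: hg => + _; exact. Qed.
Let if_ : rintegrable f. Proof. by case: hf. Qed.
Let ig : rintegrable g0. Proof. by case: hg. Qed.
Let is_ : rintegrable s. Proof. exact: rintegrableD. Qed.
Let sge0 l : circle l -> 0 <= s l.
Proof. by move=> cl; rewrite addr_ge0 ?fge0 ?gge0. Qed.

(* If g = g0 + e (f + g0), then f + g = (1 + e) (f + g0), so B and R are both
   divided by 1 + e and the coefficients of C are unchanged. *)
Let gt e l := g0 l + e * s l.

Let gtE e l : f l + gt e l = (1 + e) * s l.
Proof. by rewrite /gt /s; ring. Qed.

Let iphi : rintegrable phi := rintegrable_inv_density hadm.

Let rb l : circle l -> `|r l| <= 1.
Proof. by move=> cl; have /andP[r0 r1] := ratio_bound hf hg cl; rewrite ger0_norm. Qed.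

Let mr : measurable_fun circle r := measurable_ratio hf hadm.

Let ir : rintegrable r.
Proof. by apply: rintegrable_bounded_ae mr (ae_circleW rb). Qed.

Let qE l : q l = r l * g0 l.
Proof. by rewrite /q /r; ring. Qed.

Let iq : rintegrable q.
Proof. by rewrite (funext qE); apply: rintegrableM_bounded (ae_circleW rb) ig. Qed.

Let opB_scale e : 0 < e -> opB f (gt e) = scalemx (1 + e)^-1 (opB f g0).
Proof.
move=> e0; apply: toeplitz_scale => // l _; rewrite gtE invfM//.
Qed.

Let opR_scale e : 0 < e -> opR f (gt e) = scalemx (1 + e)^-1 (opR f g0).
Proof.
by move=> e0; apply: toeplitz_scale => // l _; rewrite gtE invfM mulrCA.
Qed.

Let opQ_symbol e l : 0 < e -> circle l ->
  f l * gt e l / (f l + gt e l) = (1 + e)^-1 * (q l + e * f l).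
Proof.
move=> e0 cl; rewrite gtE invfM mulrCA; congr (_ * _); rewrite /gt /q.
have [z|sn] := eqVneq (s l) 0; last by rewrite -/(s l); field.
(* A zero of [s] is a zero of [f], both summands being nonnegative, so both sides reduce to 0
   there. *)
have f0 : f l = 0.
  by apply/eqP; rewrite eq_le fge0// andbT; have := gge0 cl; move: z; rewrite /s; lra.
by rewrite f0 !mul0r mulr0 addr0.
Qed.

Lemma admissible_scale e : 0 < e -> admissible f (gt e).
Proof.
move=> e0; have [hi hB hI] := hadm; have k0 : 0 < (1 + e)^-1 by rewrite invr_gt0; lra.
have kn : 1 + e != 0 by rewrite gt_eqF//; lra.
split; last 2 first.
- by rewrite (opB_scale e0); exact: mx_bounded_scale (ltW k0) hB.
- by rewrite (opB_scale e0); exact: mx_bounded_inverse_scale k0 hB hI.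
have := integrableZl (mu := @lebesgue_measure R) measurable_circle (1 + e)^-1 hi.
rewrite /inv_integrable; congr (_.-integrable _ _); apply/funext => l /=.
rewrite gtE !inver mulf_eq0 (negbTE kn) /= -/(s l).
case: ifP => _; first by rewrite gt0_muley ?lte_fin.
by rewrite invfM EFinM.
Qed.

Lemma spectralC_scale e : 0 < e -> spectralC a f (gt e) = spectralC a f g0.
Proof.
move=> e0; have [_ hB _] := hadm; have kn : (1 + e)^-1 != 0 by rewrite gt_eqF// invr_gt0; lra.
rewrite /spectralC (opB_scale e0) (opR_scale e0).
rewrite (mxop_scale _ (fun j => csummable_toeplitz_l1 j ha ir)).
exact: mxinv_scale kn hB.
Qed.

Let A := Afun a.
Let Ab : ae_circle (fun l => cabs (A l) <= abs_tail a 0).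
Proof. by apply: ae_circleW => l _; exact: Afun_bounded. Qed.

Let iAf : rintegrable (fun l => cabs (A l) ^+ 2 * f l).
Proof. by apply: rintegrable_sqr_weight Ab if_; exact: cmeasurable_Afun. Qed.

Let iAq : rintegrable (fun l => cabs (A l) ^+ 2 * q l).
Proof. by apply: rintegrable_sqr_weight Ab iq; exact: cmeasurable_Afun. Qed.

Lemma Re_inner_toeplitz_Afun (w : R -> R) : rintegrable w ->
  complex.Re (inner (mxop (toeplitz w) a) a) =
  (2 * pi)^-1 * rint (fun l => cabs (A l) ^+ 2 * w l).
Proof.
move=> iw.
rewrite (_ : mxop _ a = fcoef (fun l => Afun a l * (w l)%:C)); last first.
  by apply/funext => j; exact: mxop_toeplitz_l1.
rewrite inner_fcoef_Afun//; last by apply: cintegrable_Afun => //; exact: cintegrable_real.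
rewrite (@cintegral_eq _ _ (fun l => (cabs (A l) ^+ 2 * w l)%:C)); last first.
  by move=> l; rewrite real_complexM -mulc_conj /A; ring.
by rewrite cintegral_real -real_complexM.
Qed.

Let Ar l : R[i] := A l * (r l)%:C.

Let mAr : cmeasurable Ar.
Proof.
by apply: cmeasurableM; [exact: cmeasurable_Afun|exact: cmeasurable_real].
Qed.

Let Arb : ae_circle (fun l => cabs (Ar l) <= abs_tail a 0).
Proof.
apply: ae_circleW => l cl; rewrite cabsM cabs_real.
by rewrite -[leRHS]mulr1 ler_pM ?cabs_ge0 ?rb//; exact: Afun_bounded.
Qed.

Let iArC : cintegrable (fun l => Ar l * conjc (C l)).
Proof.
apply: (cintegrableM_bounded mAr Arb); apply: cintegrable_conj.
exact: cintegrable_L2_sum hC.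
Qed.

Lemma Re_inner_spectralC :
  complex.Re (inner (mxop (opR f g0) a) (spectralC a f g0)) =
  (2 * pi)^-1 * rint (fun l => complex.Re (Ar l * conjc (C l))).
Proof.
rewrite (mxop_opR_Afun ha hf hg hadm) (inner_fcoef_L2 mAr Arb hC).
by rewrite Re_mulc /= mul0r subr0.
Qed.

Lemma inner_scalec k (x y : nat -> R[i]) :
  csummable (fun j => x j * conjc (y j)) ->
  complex.Re (inner (scalec k x) y) = k * complex.Re (inner x y).
Proof.
move=> h; rewrite /inner /scalec; under eq_fun do rewrite -mulrA.
by have [_ ->] := csum_scale k h; rewrite Re_mulc /= mul0r subr0.
Qed.

(** Estimate and error are orthogonal, so the energy of A xi is that of the estimate plus the
    minimal error; the objective is this error. *)
Lemma wiener_energy : rint (fun l => cabs (h0 l) ^+ 2 * s l) =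
  2 * pi * ((2 * pi)^-1 * rint (fun l => cabs (A l) ^+ 2 * f l)
            - complex.Re (objective a f g0)).
Proof.
have tp : 2 * pi != 0 :> R by rewrite gt_eqF// twopi_gt0.
rewrite /objective ReD Re_inner_spectralC Re_inner_toeplitz_Afun//.
rewrite -mulrDr -mulrBr mulVKf//.
have ihc : cintegrable (fun l => h0 l * conjc (C l)).
  apply: (cintegrableM_bounded (cmeasurable_wiener ha hf hadm hC) hM).
  by apply: cintegrable_conj; exact: cintegrable_L2_sum hC.
have ihs : rintegrable (fun l => cabs (h0 l) ^+ 2 * s l).
  by apply: rintegrable_sqr_weight hM is_; exact: (cmeasurable_wiener ha hf hadm hC).
have [iX _] := ihc; have [iY _] := iArC.
have X0 : rint (fun l => complex.Re (h0 l * conjc (C l))) = 0.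
  by have := congr1 (@complex.Re R) (wiener_orthC ha hf hg hadm hC hM).
rewrite -rintD// -rintB//; last exact: rintegrableD.
(* Adding the vanishing integral of Re(h0 conj C) makes the integrands agree almost everywhere:
   after substituting C = A f - h0 s each equals f Re(A conj h0). *)
rewrite -[LHS]addr0 -X0 -rintD//.
apply: rint_eq_ae; first exact: rintegrableD.
  by apply: rintegrable_measurable; apply: rintegrableB => //; exact: rintegrableD.
move: (ae_density_gt0 hf hg hadm); apply: ae_circle_imp => l _ sl.
have E : C l = A l * (f l)%:C - h0 l * (s l)%:C.
  by rewrite /wiener_char divfK ?fmorph_eq0 ?gt_eqF// /A; ring.
have Eq : q l = f l - r l * f l by rewrite /q /r; field; rewrite gt_eqF.
have Er : r l * s l = f l by rewrite /r /s divfK// gt_eqF.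
rewrite -/(q l) Eq E !cabs_sqr /Ar; move: Er.
generalize (r l) (s l) (f l) (A l) (h0 l) => x y z [a1 a2] [b1 b2] e /=.
apply/eqP; rewrite -subr_eq0.
rewrite (_ : _ - _ = (z - x * y) * (a1 * b1 + a2 * b2)); last by ring.
by rewrite e subrr mul0r.
Qed.

Lemma wiener_slack_eq0 :
  (forall g, Dg0 P g -> admissible f g ->
     complex.Re (objective a f g) <= complex.Re (objective a f g0)) ->
  (2 * pi)^-1 * rint g0 < P -> ae_circle (fun l => h0 l = 0).
Proof.
move=> hmax slack; have tp := @twopi_gt0 R.
have rs0 : 0 <= rint s by exact: rint_ge0.
have ihs : rintegrable (fun l => cabs (h0 l) ^+ 2 * s l).
  by apply: rintegrable_sqr_weight hM is_; exact: (cmeasurable_wiener ha hf hadm hC).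
(* Chosen so that [e] times the integral of f + g0 fits into the unspent power; the added 1 keeps
   the denominator positive. *)
pose e := (2 * pi * P - rint g0) / (rint s + 1).
have num0 : 0 < 2 * pi * P - rint g0.
  by rewrite subr_gt0; move: slack; rewrite mulrC ltr_pdivrMr// mulrC.
have e0 : 0 < e by rewrite divr_gt0// ltr_wpDl.
have Dg : Dg0 P (gt e).
  split; first split.
  - by move=> l cl; rewrite addr_ge0 ?gge0// mulr_ge0 ?sge0// ltW.
  - by apply: rintegrableD => //; exact: rintegrableZ.
  rewrite -/(rint (gt e)) rintD//; last exact: rintegrableZ.
  rewrite rintZ// mulrC ler_pdivrMr// [leRHS]mulrC -lerBrDl.
  rewrite /e mulrAC ler_pdivrMr ?ltr_wpDl//.
  by rewrite ler_pM2l// lerDl.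
have k1 : 0 < 1 + e by lra.
(* Here [x] and [y] stand for the two inner products at [g0] and [z] for the energy of A xi. As [v]
   is a weighted mean of x + y and z, it stays below x + y only if z does. *)
have cancel (v w x y z : R) : v = (1 + e)^-1 * (x + (y + e * z)) -> w = x + y ->
    v <= w -> z <= w.
  by move=> -> ->; rewrite (ler_pdivrMl _ _ k1) => h; rewrite -(ler_pM2l e0); lra.
have iqf : rintegrable (fun l => q l + e * f l).
  by apply: rintegrableD => //; exact: rintegrableZ.
have iAqf : rintegrable (fun l => cabs (A l) ^+ 2 * (q l + e * f l)).
  by apply: rintegrable_sqr_weight Ab iqf; exact: cmeasurable_Afun.
have hQ l : circle l -> f l * gt e l / (f l + gt e l) = (1 + e)^-1 * (q l + e * f l).
  exact: opQ_symbol.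
have igq : rintegrable (fun l => f l * gt e l / (f l + gt e l)).
  have ik := rintegrableZ (1 + e)^-1 iqf.
  apply: (rintegrable_le _ (rintegrable_abs ik)) => [|l cl]; last by rewrite hQ.
  have [_ ie] := Dg.1; apply: measurable_funM.
    by apply: measurable_funM; exact: rintegrable_measurable.
  exact: measurable_inv_density (admissible_scale e0).
have oQ : complex.Re (inner (mxop (opQ f (gt e)) a) a) =
    (1 + e)^-1 * (complex.Re (inner (mxop (opQ f g0) a) a) +
                  e * ((2 * pi)^-1 * rint (fun l => cabs (A l) ^+ 2 * f l))).
  have e1 : complex.Re (inner (mxop (opQ f g0) a) a) =
    (2 * pi)^-1 * rint (fun l => cabs (A l) ^+ 2 * q l) := Re_inner_toeplitz_Afun iq.
  transitivity ((2 * pi)^-1 * rint (fun l => cabs (A l) ^+ 2 *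
    (f l * gt e l / (f l + gt e l)))); first exact: Re_inner_toeplitz_Afun igq.
  rewrite e1 [e * _]mulrCA -mulrDr mulrCA; congr (_ * _).
  rewrite -rintZ// -rintD//; last exact: rintegrableZ.
  rewrite -rintZ; last by apply: rintegrableD => //; exact: rintegrableZ.
  by apply: rint_eq => l cl; rewrite hQ//; ring.
have oR : complex.Re (inner (mxop (opR f (gt e)) a) (spectralC a f (gt e))) =
    (1 + e)^-1 * complex.Re (inner (mxop (opR f g0) a) (spectralC a f g0)).
  rewrite (spectralC_scale e0) (opR_scale e0).
  rewrite (mxop_scale _ (fun j => csummable_toeplitz_l1 j ha ir)).
  apply: inner_scalec; rewrite (mxop_opR_Afun ha hf hg hadm).
  exact: ccvg_csummable (ccvg_inner_fcoef_L2 mAr Arb hC).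
have E1 : complex.Re (objective a f (gt e)) = (1 + e)^-1 *
    (complex.Re (inner (mxop (opR f g0) a) (spectralC a f g0)) +
     (complex.Re (inner (mxop (opQ f g0) a) a) +
      e * ((2 * pi)^-1 * rint (fun l => cabs (A l) ^+ 2 * f l)))).
  exact: etrans (ReD _ _) (etrans (congr2 +%R oR oQ) (esym (mulrDr _ _ _))).
have Fo := cancel _ _ _ _ _ E1 (ReD _ _) (hmax _ Dg (admissible_scale e0)).
have hle : rint (fun l => cabs (h0 l) ^+ 2 * s l) <= 0.
  rewrite wiener_energy; apply: mulr_ge0_le0; first exact: ltW.
  by rewrite subr_le0; exact: Fo.
have := rint_eq0_ae ihs (fun l cl => mulr_ge0 (sqr_ge0 _) (sge0 cl)) hle.
move=> z; move: (ae_circle_and z (ae_density_gt0 hf hg hadm)).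
apply: ae_circle_imp => l _ [/eqP + sl].
rewrite mulf_eq0 (gt_eqF sl) orbF sqrf_eq0 => /eqP.
exact: ComplexField.Normc.eq0_normc.
Qed.

End LeastFavourable.

(** * The saddle point and its two consequences *)

Unset Implicit Arguments.

Theorem theorem5p3 (R : realType) (a : nat -> R[i]) (P2 alpha2 : R)
  (f g0 : R -> R) (C0 : R -> R[i])
  (ha1 : cvgn (series (fun j => cabs (a j))))
  (ha2 : cvgn (series (fun j => j.+1%:R * cabs (a j) ^+ 2)))
  (hP2 : 0 < P2)
  (hf : spectral_density f)
  (hg0 : Dg0 P2 g0)
  (hadm : admissible f g0)
  (hC0 : is_L2_sum (spectralC a f g0) C0)
  (hbdd : exists M : R, {ae @lebesgue_measure R, forall l, circle l ->
     cabs (Afun a l * (f l)%:C - C0 l) ^+ 2 / (f l + g0 l) ^+ 2 <= M})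
  (halpha2 : 0 < alpha2)
  (hg0E : {ae @lebesgue_measure R, forall l, circle l ->
     g0 l = Num.max 0
       (alpha2^-1 * cabs (Afun a l * (f l)%:C - C0 l) - f l)})
  (hmax : forall g, Dg0 P2 g -> admissible f g ->
     complex.Re (objective a f g) <= complex.Re (objective a f g0)) :
  least_favourable a f (Dg0 P2) g0 /\
  minimax_robust a f (Dg0 P2)
    (fun l => (Afun a l * (f l)%:C - C0 l) / (f l + g0 l)%:C).
Proof.
have [hg0s hg0P] := hg0; have [fge0 if_] := hf; have [gge0 ig0] := hg0s.
have tp := @twopi_gt0 R.
pose h0 := wiener_char a f g0 C0.
(* The maximum is at least its second entry, which bounds |A f - C| by alpha2 (f + g0); where [g0]
   is positive the maximum is that entry and the bound is attained. *)
have hbound : ae_circle (fun l => cabs (h0 l) <= alpha2 /\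
    (0 < g0 l -> cabs (h0 l) = alpha2)).
  move: (ae_circle_and (ae_density_gt0 hf hg0s hadm) hg0E).
  apply: ae_circle_imp => l _ [sl gE].
  set N := cabs _ in gE.
  have hE : cabs (h0 l) = N / (f l + g0 l).
    rewrite /h0 /wiener_char cabsM -(fmorphV (real_complex R)) cabs_real.
    by rewrite ger0_norm// invr_ge0 ltW.
  have g_ge : alpha2^-1 * N - f l <= g0 l by rewrite [leRHS]gE le_max lexx orbT.
  have N_le : N <= alpha2 * (f l + g0 l) by rewrite -ler_pdivrMl//; lra.
  split; first by rewrite hE ler_pdivrMr.
  move=> g_gt0; have g_eq : g0 l = alpha2^-1 * N - f l.
    have [h|h] := leP (alpha2^-1 * N - f l) 0; last by rewrite gE max_r// ltW.
    by move: g_gt0; rewrite gE max_l// ltxx.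
  have e : f l + g0 l = alpha2^-1 * N by rewrite g_eq; ring.
  have N0 : N != 0 by apply: contraTneq sl => z; rewrite e z mulr0 ltxx.
  by rewrite hE e invfM invrK mulrCA divff// mulr1.
have hM : ae_circle (fun l => cabs (h0 l) <= alpha2).
  by move: hbound; apply: ae_circle_imp => l _ [].
have mh : cmeasurable h0 := cmeasurable_wiener ha1 hf hadm hC0.
have opt h : L2past f g0 h -> (Delta a h0 f g0 <= Delta a h f g0)%E.
  exact: (wiener_optimal ha1 hf hg0s hadm hC0 hM).
have past g : Dg0 P2 g -> L2past f g h0.
  move=> [hg _]; apply: (L2past_bounded hf hg mh hM) => m.
  exact: wiener_orth.
have ihg w : rintegrable w -> rintegrable (fun l => cabs (h0 l) ^+ 2 * w l).
  exact: (rintegrable_sqr_weight mh hM).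
have iAf : rintegrable (fun l => cabs (Afun a l - h0 l) ^+ 2 * f l).
  apply: (rintegrable_sqr_weight _ (sqr_error_bounded ha1 hM) if_).
  by apply: cmeasurableB => //; exact: cmeasurable_Afun.
(* Where [g0] vanishes both integrands do, so |h0| = alpha2 is used only where it is known. *)
have energy0 : rint (fun l => cabs (h0 l) ^+ 2 * g0 l) = alpha2 ^+ 2 * rint g0.
  rewrite -rintZ//; apply: rint_eq_ae; first exact: ihg.
    by apply: rintegrable_measurable; exact: rintegrableZ.
  move: hbound; apply: ae_circle_imp => l cl [_ h].
  have := gge0 l cl; rewrite le_eqVlt => /predU1P[<-|/h ->//].
  by rewrite !mulr0.
have energy_le g : Dg0 P2 g ->
    rint (fun l => cabs (h0 l) ^+ 2 * g l) <= rint (fun l => cabs (h0 l) ^+ 2 * g0 l).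
  move=> [[gge ig] gP].
  have [full|slack] := leP P2 ((2 * pi)^-1 * rint g0).
    rewrite energy0; apply: (@le_trans _ _ (alpha2 ^+ 2 * rint g)).
      rewrite -rintZ//; apply: rint_le_ae; [exact: ihg|exact: rintegrableZ|].
      move: hM; apply: ae_circle_imp => l cl hl; rewrite ler_wpM2r ?gge//.
      by rewrite ler_sqr ?nnegrE ?cabs_ge0// ltW.
    rewrite ler_wpM2l ?sqr_ge0//.
    have tp' : 0 < (2 * pi : R)^-1 by rewrite invr_gt0.
    by rewrite -(ler_pM2l tp'); exact: le_trans gP full.
  have hz := wiener_slack_eq0 ha1 hf hg0s hadm hC0 hM hmax slack.
  rewrite (@rint_eq_ae _ _ (cst 0)); [|exact: ihg|exact: measurable_cst|].
    by rewrite rint_cst mul0r; apply: rint_ge0 => l cl; rewrite mulr_ge0 ?sqr_ge0 ?gge0.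
  by move: hz; apply: ae_circle_imp => l _ z; rewrite /h0 z cabs0 expr0n mul0r.
have saddle g : Dg0 P2 g -> (Delta a h0 f g <= Delta a h0 f g0)%E.
  move=> Dg; have ig : rintegrable g by case: Dg => -[].
  rewrite !Delta_rint//; [|exact: ihg..]; rewrite lee_fin.
  by rewrite ler_wpM2l ?invr_ge0 ?(ltW tp)// lerD2l energy_le.
split.
  split=> //; exists h0; first by split; [exact: past|exact: opt].
  (* [h0] competes in the estimation problem of every [g], so the error of the optimal [h] is at
     most that of [h0] for the same [g]. *)
  move=> g Dg h [_ hopt]; exact: le_trans (hopt _ (past g Dg)) (saddle g Dg).
split; first by move=> g Dg; exact: past.
apply/eqP; rewrite eq_le; apply/andP; split.
  by apply: ereal_inf_lbound; exists h0 => // g Dg; exact: past.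
(* The supremum for [h0] is at most its error at [g0], which is at most the error of [h] at [g0],
   hence at most the supremum for [h]. The middle link uses that [HD] is contained in
   [L2past f g0]. *)
apply: le_ereal_inf_tmp => _ [h hHD <-].
apply: (@le_trans _ _ (Delta a h0 f g0)).
  by apply: ge_ereal_sup => _ [g Dg <-]; exact: saddle.
apply: (le_trans (opt _ (hHD g0 hg0))).
by apply: ereal_sup_ubound; exists g0.
Qed.
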